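(* Let $K\subset\mathbb{R}^d$ be a bounded measurable set with positive Lebesgue measure, and let $$\Lambda=\begin{pmatrix} A & O\\ C & B\end{pmatrix}(\mathbb{Z}^{2d}),\qquad |\det(AB)|=1,$$ where $A,B,C$ are real $d\times d$ matrices. Suppose that $\mathcal{G}(|K|^{-1/2}\chi_K,\Lambda)$ is a Gabor orthonormal basis for $L^2(\mathbb{R}^d)$ and that $A^tB$ is an integer matrix. Then $K$ tiles $\mathbb{R}^d$ by translations and is a spectral set. More precisely, $K$ is a common fundamental domain for $A(\mathbb{Z}^d)$ and $B^{-t}(\mathbb{Z}^d)$, $K$ tiles by $A(\mathbb{Z}^d)$, and $K$ is spectral with spectrum $B(\mathbb{Z}^d)$.
   Context: $|K|$ denotes Lebesgue measure, $\chi_K$ the indicator function of $K$, $A^t$ the transpose of $A$, and $B^{-t}$ the inverse transpose of $B$. For $g\in L^2(\mathbb{R}^d)$ and a countable set $\Lambda\subset\mathbb{R}^{2d}$, the Gabor system $\mathcal{G}(g,\Lambda)$ is the collection of functions $\pi(a,b)g(x)=e^{2\pi i\langle b,x\rangle}g(x-a)$, $(a,b)\in\Lambda$ (with $a,b\in\mathbb{R}^d$); it is a Gabor orthonormal basis if it is an orthonormal basis of $L^2(\mathbb{R}^d)$. A set $K$ of positive finite measure is spectral with spectrum $\Gamma$ ($\Gamma\subset\mathbb{R}^d$ countable) if $\{e^{2\pi i\langle\gamma,x\rangle}:\gamma\in\Gamma\}$ is an orthogonal basis of $L^2(K)$. $K$ tiles $\mathbb{R}^d$ by a countable set $\mathcal{J}\subset\mathbb{R}^d$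 if $\sum_{t\in\mathcal{J}}\chi_K(x+t)=1$ for a.e. $x\in\mathbb{R}^d$. A fundamental domain of a full-rank lattice $\Gamma\subset\mathbb{R}^d$ is a measurable set meeting every coset $x+\Gamma$ in exactly one point, understood up to sets of Lebesgue measure zero. *)

(* Defs.v *)
From HB Require Import structures.
From mathcomp Require Import all_boot all_order all_algebra.
From mathcomp Require Import all_classical all_reals all_analysis.
From mathcomp Require Import complex.

Set Implicit Arguments.
Unset Strict Implicit.
Unset Printing Implicit Defensive.

Import Order.TTheory GRing.Theory Num.Theory.
Import numFieldNormedType.Exports.

Local Open Scope classical_set_scope.
Local Open Scope ring_scope.

Definition measure_cV_display : measure_display -> measure_display.
Proof. exact. Qed.

(* Column vectors carry the sigma-algebra generated by the coordinates, which
   for real entries is the Borel sigma-algebra. *)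
Section measurable_cV.
Context {d : measure_display} {T : measurableType d}.
Variable n : nat.

Let coors : 'I_n -> 'cV[T]_n -> T := fun i x => x i ord0.

Let cV_set0 : g_sigma_preimage coors set0.
Proof. exact: sigma_algebra0. Qed.

Let cV_setC A : g_sigma_preimage coors A -> g_sigma_preimage coors (~` A).
Proof. exact: sigma_algebraC. Qed.

Let cV_bigcup (F : _^nat) : (forall i, g_sigma_preimage coors (F i)) ->
  g_sigma_preimage coors (\bigcup_i (F i)).
Proof. exact: sigma_algebra_bigcup. Qed.

HB.instance Definition _ := @isMeasurable.Build (measure_cV_display d)
  'cV[T]_n (g_sigma_preimage coors) cV_set0 cV_setC cV_bigcup.

End measurable_cV.

Lemma measurable_coord {d : measure_display} {T : measurableType d} n
    (i : 'I_n) : measurable_fun [set: 'cV[T]_n] (fun x => x i ord0).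
Proof.
move=> _ Y mY; rewrite setTI; apply: sub_sigma_algebra => /=.
rewrite -bigcup_seq/=; exists i => /=; first by rewrite mem_index_enum.
by exists Y => //; rewrite setTI.
Qed.

Lemma measurable_fun_cVP {d1 d2 : measure_display} {T1 : measurableType d1}
    {T2 : measurableType d2} n (f : T1 -> 'cV[T2]_n) :
  (forall i, measurable_fun [set: T1] (fun x => f x i ord0)) ->
  measurable_fun [set: T1] f.
Proof.
move=> mf.
suff H : g_sigma_preimage (fun i x => f x i ord0) `<=` measurable.
  move=> _ A mA; rewrite setTI; apply: H.
  have -> : (fun i x => f x i ord0) =
      (fun i : 'I_n => (fun v : 'cV[T2]_n => v i ord0) \o f) by [].
  by rewrite g_sigma_preimage_comp; exists A => //; rewrite setTI.
apply: smallest_sub; first exact: sigma_algebra_measurable.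
rewrite -bigcup_seq; apply: bigcup_sub => i _ A [B mB <-].
exact: mf.
Qed.

Section lebesgue_cV.
Context {R : realType}.

Definition cV_cons n (p : (R * 'cV[R]_n)%type) : 'cV[R]_n.+1 := col_mx p.1%:M p.2.

Definition cV_uncons n (v : 'cV[R]_n.+1) : (R * 'cV[R]_n)%type :=
  (v ord0 ord0, dsubmx (v : 'M[R]_(1 + n, 1))).

Lemma cV_cons0 n p : @cV_cons n p ord0 ord0 = p.1.
Proof.
transitivity (col_mx (p.1%:M : 'M[R]_1) p.2 (lshift n ord0) ord0).
  by congr (col_mx _ _ _ _); exact/val_inj.
by rewrite col_mxEu mxE.
Qed.

Lemma cV_consS n p i : @cV_cons n p (lift ord0 i) ord0 = p.2 i ord0.
Proof.
transitivity (col_mx (p.1%:M : 'M[R]_1) p.2 (rshift 1 i) ord0).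
  by congr (col_mx _ _ _ _); exact/val_inj.
by rewrite col_mxEd.
Qed.

Lemma cV_consK n : cancel (@cV_cons n) (@cV_uncons n).
Proof.
by move=> [x v]; rewrite /cV_uncons cV_cons0 /= /cV_cons col_mxKd.
Qed.

Lemma measurable_cV_cons n :
  measurable_fun [set: (R * 'cV[R]_n)%type] (@cV_cons n).
Proof.
apply: measurable_fun_cVP => i; case: (unliftP ord0 i) => [j ->|->].
  under eq_fun do rewrite cV_consS.
  apply: (measurableT_comp (measurable_coord j)); exact: measurable_snd.
by under eq_fun do rewrite cV_cons0; exact: measurable_fst.
Qed.

Lemma measurable_cV_uncons n : measurable_fun [set: 'cV[R]_n.+1] (@cV_uncons n).
Proof.
apply/measurable_fun_pairP; split; first exact: measurable_coord.
apply: measurable_fun_cVP => i.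
rewrite (_ : (fun _ => _) = fun v : 'cV[R]_n.+1 => v (rshift 1 i) ord0).
  exact: measurable_coord.
by apply/funext => v /=; rewrite mxE.
Qed.

Section step.
Variables (n : nat) (mu : {sigma_finite_measure set 'cV[R]_n -> \bar R}).

Definition cV_measureS : set 'cV[R]_n.+1 -> \bar R :=
  pushforward (@lebesgue_measure R \x mu)%E (@cV_cons n).

Let cV_measureS0 : cV_measureS set0 = 0%E.
Proof. by rewrite /cV_measureS /pushforward preimage_set0 measure0. Qed.

Let cV_measureS_ge0 A : (0 <= cV_measureS A)%E.
Proof. by rewrite /cV_measureS /pushforward measure_ge0. Qed.

Let cV_measureS_sigma_additive : semi_sigma_additive cV_measureS.
Proof.
move=> F mF tF mUF; rewrite /cV_measureS /pushforward preimage_bigcup.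
apply: measure_semi_sigma_additive.
- by move=> k; rewrite -[X in measurable X]setTI; exact: measurable_cV_cons.
- apply/trivIsetP => /= i j _ _ ij; rewrite -preimage_setI.
  by move/trivIsetP : tF => /(_ _ _ _ _ ij) ->//; rewrite preimage_set0.
- rewrite -preimage_bigcup -[X in measurable X]setTI.
  exact: measurable_cV_cons.
Qed.

HB.instance Definition _ := isMeasure.Build _ _ _ cV_measureS
  cV_measureS0 cV_measureS_ge0 cV_measureS_sigma_additive.

Let cV_measureS_sigma_finite : sigma_finite setT cV_measureS.
Proof.
have /sigma_finiteP[F [TF ndF Foo]] := sigma_finiteT (@lebesgue_measure R).
have /sigma_finiteP[G [TG ndG Goo]] := sigma_finiteT mu.
exists (fun k => @cV_uncons n @^-1` (F k `*` G k)).
  rewrite -preimage_bigcup; apply/esym/seteqP; split => // v _ /=.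
  have [i _ Fi] : (\bigcup_k F k) (cV_uncons v).1 by rewrite -TF.
  have [j _ Gj] : (\bigcup_k G k) (cV_uncons v).2 by rewrite -TG.
  exists (maxn i j) => //; split.
    by move: Fi; exact/subsetPset/ndF/leq_maxl.
  by move: Gj; exact/subsetPset/ndG/leq_maxr.
move=> k; have [? ?] := Foo k; have [? ?] := Goo k; split.
  rewrite -[X in measurable X]setTI; apply: measurable_cV_uncons => //.
  exact: measurableX.
rewrite /cV_measureS /pushforward -comp_preimage.
rewrite (_ : _ \o _ = id); last by apply/funext => p /=; rewrite cV_consK.
by rewrite [ltLHS]product_measure1E// lte_mul_pinfty// ge0_fin_numE.
Qed.

HB.instance Definition _ := @Measure_isSigmaFinite.Build _ _ _ cV_measureS
  cV_measureS_sigma_finite.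

End step.

(* The n-fold product of the one-dimensional Lebesgue measure; it is the unit
   mass on the one-point space when n = 0. *)
Fixpoint borel_lebesgue n : {sigma_finite_measure set 'cV[R]_n -> \bar R} :=
  match n return {sigma_finite_measure set 'cV[R]_n -> \bar R} with
  | 0 => \d_(0 : 'cV[R]_0)
  | n.+1 => cV_measureS (borel_lebesgue n)
  end.

Lemma borel_lebesgue_box n (a b : 'cV[R]_n) :
  (forall i, a i ord0 <= b i ord0) ->
  borel_lebesgue n [set v | forall i, v i ord0 \in `[a i ord0, b i ord0]] =
  (\prod_(i < n) (b i ord0 - a i ord0))%:E.
Proof.
elim: n a b => [|n ih] a b ab /=.
  by rewrite big_ord0 diracE mem_set// => -[].
rewrite /cV_measureS /pushforward.
set B := [set v : 'cV[R]_n |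
  forall i, v i ord0 \in `[a (lift ord0 i) ord0, b (lift ord0 i) ord0]].
rewrite (_ : _ @^-1` _ = `[a ord0 ord0, b ord0 ord0]%classic `*` B); last first.
  apply/seteqP; split => [p /= abp|p /= [p1 p2] i].
    split; first by have := abp ord0; rewrite cV_cons0.
    by move=> i; have := abp (lift ord0 i); rewrite cV_consS.
  by case: (unliftP ord0 i) => [j ->|->]; rewrite ?cV_consS ?cV_cons0//; exact: p2.
have mB : measurable B.
  have -> : B = \bigcap_(i in [set: 'I_n]) ((fun v : 'cV[R]_n => v i ord0) @^-1`
      `[a (lift ord0 i) ord0, b (lift ord0 i) ord0]%classic).
    by apply/seteqP; split => v vB i; [move=> _|]; exact: vB.
  apply: fin_bigcap_measurable => // i _; rewrite -[X in measurable X]setTI.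
  by apply: measurable_coord.
have {}ih : borel_lebesgue n B =
    (\prod_(i < n) (b (lift ord0 i) ord0 - a (lift ord0 i) ord0))%:E.
  under eq_bigr => i _ do
    rewrite -(mxE matrix_key (fun i _ => b (lift ord0 i) ord0) i (ord0 : 'I_1))
            -(mxE matrix_key (fun i _ => a (lift ord0 i) ord0) i (ord0 : 'I_1)).
  rewrite -ih => [|i]; last by rewrite !mxE.
  by congr (borel_lebesgue n _); apply/seteqP; split => v vB i;
    have := vB i; rewrite !mxE.
rewrite [LHS]product_measure1E//= ih.
rewrite lebesgue_measure_itv/= lte_fin big_ord_recl EFinM.
congr (_ * _)%E.
case: ltgtP (ab ord0) => // ->; by rewrite subrr.
Qed.

(* The space of column vectors again, now with the Lebesgue (completed)
   sigma-algebra; the canonical sigma-algebra on 'cV[R]_n is only the Borel one,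
   so sets and functions below are typed over euclid. *)
Definition euclid n : Type := caratheodory_type (borel_lebesgue n)^*%mu.
HB.instance Definition _ n := Measurable.copy (euclid n)
  (caratheodory_type (borel_lebesgue n)^*%mu).

Definition lebesgue n : set (euclid n) -> \bar R :=
  @completed_measure_extension _ _ _ (borel_lebesgue n).
HB.instance Definition _ n := Measure.on (lebesgue (n := n)).

Lemma lebesgueE n (A : set 'cV[R]_n) : measurable A ->
  lebesgue A = borel_lebesgue n A.
Proof. exact: measurable_mu_extE. Qed.

Let lebesgue_sigma_finite n : sigma_finite setT (@lebesgue n).
Proof.
by apply: completed_measure_extension_sigma_finite; exact: sigma_finiteT.
Qed.

HB.instance Definition _ n := @Measure_isSigmaFinite.Build _ _ _ (@lebesgue n)
  (@lebesgue_sigma_finite n).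
End lebesgue_cV.
Arguments euclid : clear implicits.
Arguments lebesgue : clear implicits.

Local Open Scope complex_scope.

Section complex_L2.
Context {R : realType} {d : nat}.
Implicit Types (D : set (euclid R d)) (f g : euclid R d -> R[i]).

Definition complex_integral D f : R[i] :=
  (\int[lebesgue R d]_(x in D) complex.Re (f x)) +i*
  (\int[lebesgue R d]_(x in D) complex.Im (f x)).

(* The square of the L^2(D) distance. *)
Definition L2dist2 D f g : \bar R :=
  (\int[lebesgue R d]_(x in D) (complex.Re (`|f x - g x| ^+ 2))%:E)%E.

Definition L2 D f :=
  [/\ measurable_fun D (fun x => complex.Re (f x)),
      measurable_fun D (fun x => complex.Im (f x)) &
      (L2dist2 D f (fun=> 0%R) < +oo)%E].

Definition inner_L2 D f g : R[i] := complex_integral D (fun x => f x * (g x)^*).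

(* The finite linear combinations of the family e, indexed by L, are dense in
   L^2(D). *)
Definition dense_span D (I : Type) (L : set I) (e : I -> euclid R d -> R[i]) :=
  forall f, L2 D f -> forall eps : R, 0 < eps ->
    exists n (t : 'I_n -> I) (c : 'I_n -> R[i]), (forall k, L (t k)) /\
      (L2dist2 D f (fun x => (\sum_(k < n) c k * e (t k) x)%R) < (eps ^+ 2)%:E)%E.

Definition orthogonal_basis D (I : Type) (L : set I)
    (e : I -> euclid R d -> R[i]) :=
  [/\ forall i, L i -> L2 D (e i),
      forall i, L i -> inner_L2 D (e i) (e i) <> 0,
      forall i j, L i -> L j -> i <> j -> inner_L2 D (e i) (e j) = 0 &
      dense_span D L e].

Definition orthonormal_basis D (I : Type) (L : set I)
    (e : I -> euclid R d -> R[i]) :=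
  orthogonal_basis D L e /\ forall i, L i -> inner_L2 D (e i) (e i) = 1.

End complex_L2.

Section gabor.
Context {R : realType} {d : nat}.
Implicit Types (K : set (euclid R d)) (L J : set 'cV[R]_d).

Definition dotp (u v : 'cV[R]_d) : R := \sum_(i < d) u i ord0 * v i ord0.

(* x |-> e^{2 pi i <b, x>} *)
Definition plane_wave (b : 'cV[R]_d) (x : euclid R d) : R[i] :=
  cos (2 * pi * dotp b x) +i* sin (2 * pi * dotp b x).

(* l stacks the translation parameter a on top of the modulation parameter b. *)
Definition gabor_atom (g : euclid R d -> R[i]) (l : 'cV[R]_(d + d))
    (x : euclid R d) : R[i] :=
  plane_wave (dsubmx l) x * g ((x : 'cV[R]_d) - usubmx l).

Definition gabor_orthonormal_basis (g : euclid R d -> R[i])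
    (L : set 'cV[R]_(d + d)) :=
  [/\ L2 setT g, countable L & orthonormal_basis setT L (gabor_atom g)].

Definition normalized_indic K (x : euclid R d) : R[i] :=
  ((Num.sqrt (fine (lebesgue R d K)))^-1 * \1_K x)%:C.

Definition spectral K L :=
  [/\ measurable K, (0 < lebesgue R d K < +oo)%E, countable L &
      orthogonal_basis K L plane_wave].

Definition tiles K J :=
  countable J /\
  {ae lebesgue R d, forall x : euclid R d,
    (\esum_(t in J) (\1_K ((x : 'cV[R]_d) + t)%R : R)%:E = 1)%E}.

Definition lattice n (M : 'M[R]_n) : set 'cV[R]_n :=
  [set M *m map_mx intr z | z in [set: 'cV[int]_n]].

Definition full_rank_lattice L :=
  exists2 M : 'M[R]_d, M \in unitmx & L = lattice M.

Definition exact_fundamental_domain L K :=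
  measurable K /\
  forall x : 'cV[R]_d, exists! y : 'cV[R]_d, (K `&` [set x + v | v in L]) y.

(* Fundamental domains are understood up to Lebesgue-null sets. *)
Definition fundamental_domain L K :=
  [/\ full_rank_lattice L, measurable K &
      exists2 K', exact_fundamental_domain L K' & lebesgue R d (K `+` K') = 0].

End gabor.

(* Main.v *)
(* Put P = A^t B, a unimodular integer matrix, so that A Z^d and B^-t Z^d are the
   same lattice G.  For z in Z^d let D z be the intersection of K and K + A z.
   Orthogonality of the atoms says that exp(2 pi i <C z + B k, x>) integrates to 0
   over D z for every k, as soon as z <> 0.  If some D z with z <> 0 is not null,
   take such a z of maximal Euclidean length (K is bounded).  By the parallelogram
   law one of z + k, z - k is longer than z for every k <> 0, so the G-translates
   of D z are almost disjoint; a measurable phase of modulus 1 on such a set is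
   determined by its Fourier coefficients along B Z^d, which all vanish, so D z
   is null, a contradiction.  Hence the G-translates of K are almost disjoint.
   Density of the span forces them to cover the space, and restricting Gabor
   approximations to K, where only the atoms with z = 0 survive, shows that the
   exponentials with frequencies in B Z^d span L^2(K).

   The Fourier uniqueness used above is obtained without kernels: the bounded
   functions that preserve, by multiplication, the annihilator of the exponentials
   form an algebra closed under bounded limits, hence contain the indicator of
   every Borel set invariant under G. *)
Require Import Defs.
From mathcomp Require Import all_boot all_order all_algebra.
From mathcomp Require Import all_classical all_reals all_analysis.
From mathcomp Require Import measurable_realfun complex ring lra zify.

Import Order.TTheory GRing.Theory Num.Theory.
Import numFieldNormedType.Exports.

Local Open Scope classical_set_scope.
Local Open Scope ring_scope.

Set Implicit Arguments.
Unset Strict Implicit.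
Unset Printing Implicit Defensive.

(** * Translation invariance and Borel hulls *)

Section translation.
Context {R : realType}.

Let mu := @lebesgue_measure R.

(** The translated measure agrees with Lebesgue measure on half-open intervals, and these determine
    it. *)
Lemma lebesgue_measure_shift (t : R) (A : set R) : measurable A ->
  mu ((fun x => x + t) @^-1` A) = mu A.
Proof.
move=> mA.
have mf : measurable_fun [set: measurableTypeR R]
    ((fun x => x + t) : measurableTypeR R -> measurableTypeR R).
  exact: measurable_funD.
rewrite -[LHS]/(pushforward mu
  ((fun x => x + t) : measurableTypeR R -> measurableTypeR R) A).
apply/esym/lebesgue_measure_unique => //= _ [[a b]] _ <-.
rewrite /pushforward (_ : _ @^-1` _ = `]a - t, b - t]%classic).
  rewrite !lebesgue_measure_itv/= !lte_fin ltrD2r.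
  by case: ifPn => // _; congr (_%:E); ring.
by apply/seteqP; split => x /=; rewrite !in_itv/= ltrBlDr lerBrDr.
Qed.

Lemma measurable_shift n (t : 'cV[R]_n) :
  measurable_fun [set: 'cV[R]_n] (fun x => x + t).
Proof.
apply: measurable_fun_cVP => i; under eq_fun do rewrite mxE.
by apply: measurable_funD => //; exact: measurable_coord.
Qed.

(** Induction on the dimension: a translation acts separately on the first coordinate and on the
    tail, so the image measure has the product value on rectangles and uniqueness of the product
    measure applies. *)
Lemma borel_lebesgue_shift n (t : 'cV[R]_n) (A : set 'cV[R]_n) :
  measurable A -> borel_lebesgue n ((fun x => x + t) @^-1` A) = borel_lebesgue n A.
Proof.
elim: n t A => [|n ih] t A mA.
  by congr (borel_lebesgue _ _); apply/seteqP; split => x /=; rewrite !flatmx0.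
pose f (p : measurableTypeR R * 'cV[R]_n) : (measurableTypeR R * 'cV[R]_n)%type :=
  (p.1 + (cV_uncons t).1, p.2 + (cV_uncons t).2).
have mf : measurable_fun setT f.
  apply/measurable_fun_pairP; split => /=.
    by apply: measurable_funD => //; exact: measurable_fst.
  apply: (measurableT_comp (measurable_shift _)); exact: measurable_snd.
rewrite /= /cV_measureS /pushforward.
have mB : measurable ((@cV_cons R n) @^-1` A).
  by rewrite -[X in measurable X]setTI; exact: measurable_cV_cons.
transitivity (pushforward (lebesgue_measure \x borel_lebesgue n)%E f
    (@cV_cons R n @^-1` A)).
  congr ((_ \x _)%E _); apply/seteqP; split => -[x v] /=;
  rewrite (_ : cV_cons (x, v) + t = cV_cons (f (x, v)))//;
  apply/colP => i; rewrite mxE; case: (unliftP ord0 i) => [j ->|->];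
  rewrite ?cV_consS ?cV_cons0//= !mxE; congr (_ + t _ _); exact/val_inj.
apply/esym/product_measure_unique => // X Y mX mY.
rewrite /= /pushforward (_ : f @^-1` _ =
    ((fun x => x + (cV_uncons t).1) @^-1` X) `*`
    ((fun x => x + (cV_uncons t).2) @^-1` Y))//.
rewrite product_measure1E//=; last 2 first.
- rewrite -[X in measurable X]setTI; apply: measurable_funD => //.
- by rewrite -[X in measurable X]setTI; exact: measurable_shift.
by rewrite ih// [X in (X * _)%E]lebesgue_measure_shift.
Qed.

(** A countable Borel cover of [X] translates to one of the preimage with the same total mass. The
    reverse inequality is this one for [- t]. *)
Lemma mu_ext_shift n (t : 'cV[R]_n) (X : set 'cV[R]_n) :
  ((borel_lebesgue n)^*%mu ((fun x => x + t)%R @^-1` X) <=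
   (borel_lebesgue n)^*%mu X)%E.
Proof.
apply: le_ereal_inf_tmp => _ [F [mF XF] <-]; apply: ereal_inf_lbound.
exists (fun k => (fun x => x + t) @^-1` (F k)).
  split=> [k|x /= /XF[k _ Fk]]; last by exists k.
  by rewrite -[X in measurable X]setTI; exact: measurable_shift.
by apply: eq_eseriesr => k _; exact: borel_lebesgue_shift.
Qed.

Lemma preimage_shiftK n (t : 'cV[R]_n) (X : set 'cV[R]_n) :
  (fun x => x - t) @^-1` ((fun x => x + t) @^-1` X) = X.
Proof. by apply/seteqP; split => x /=; rewrite subrK. Qed.

Lemma lebesgue_shift n (t : 'cV[R]_n) (X : set (euclid R n)) :
  lebesgue R n ((fun x : 'cV[R]_n => x + t) @^-1` X) = lebesgue R n X.
Proof.
apply/eqP; rewrite eq_le mu_ext_shift/=.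
by rewrite -[in leLHS](preimage_shiftK t X); exact: mu_ext_shift.
Qed.

(** The Caratheodory criterion for [X] is applied to a translate of the test set [Y];
    [lebesgue_shift] holds for arbitrary sets, since [lebesgue] is the outer measure itself. *)
Lemma measurable_euclid_shift n (t : 'cV[R]_n) (X : set (euclid R n)) :
  measurable X ->
  measurable ((fun x : 'cV[R]_n => x + t) @^-1` X : set (euclid R n)).
Proof.
move=> mX.
change (caratheodory_measurable ((borel_lebesgue n)^*)%mu
  ((fun x : 'cV[R]_n => x + t) @^-1` X)).
have {}mX : caratheodory_measurable ((borel_lebesgue n)^*)%mu X by [].
move=> Y.
have sh := @lebesgue_shift n (- t); rewrite /lebesgue/completed_measure_extension in sh.
rewrite -(sh Y) [LHS]mX; congr (_ + _)%E; rewrite -[RHS]sh;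
  by congr ((_^*)%mu _); apply/seteqP; split => x /=; rewrite subrK.
Qed.

Lemma borel_measurable_euclid n (X : set 'cV[R]_n) :
  measurable X -> measurable (X : set (euclid R n)).
Proof. by move=> mX; exact: caratheodory_measurable_mu_ext. Qed.

Lemma lebesgue_complete n : measure_is_complete (lebesgue R n).
Proof. exact: measure_is_complete_caratheodory. Qed.

Lemma negligible_shift n (t : 'cV[R]_n) (X : set (euclid R n)) :
  (lebesgue R n).-negligible X ->
  (lebesgue R n).-negligible ((fun x : 'cV[R]_n => x + t) @^-1` X).
Proof.
move=> [Y [mY Y0 XY]]; exists ((fun x : 'cV[R]_n => x + t) @^-1` Y); split.
- exact: measurable_euclid_shift.
- by rewrite lebesgue_shift.
- exact: preimage_subset.
Qed.

(** Intersect Borel sets containing [X] whose mass exceeds that of [X] by at most 1/(k+1). The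
    multiplier argument reaches Borel sets only, hence the need for a Borel set equal to [X] up to a
    null set. *)
Lemma borel_hull n (X : set (euclid R n)) : measurable X ->
  (lebesgue R n X < +oo)%E ->
  exists G : set 'cV[R]_n,
    [/\ measurable G, X `<=` G & (lebesgue R n).-negligible (G `\` X)].
Proof.
move=> mX Xoo.
have XE : lebesgue R n X \is a fin_num by rewrite ge0_fin_numE.
have h k : exists G : set 'cV[R]_n, [/\ measurable G, X `<=` G &
    (lebesgue R n G <= lebesgue R n X + k.+1%:R^-1%:E)%E].
  have e0 : 0 < k.+1%:R^-1 :> R by rewrite invr_gt0.
  have [_ [F [mF XF] <-] lt] := lb_ereal_inf_adherent e0 XE.
  exists (\bigcup_k F k); split => //; first exact: bigcupT_measurable.
  apply: le_trans (ltW lt).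
  apply: (@le_trans _ _ (\sum_(k <oo) lebesgue R n (F k))%E).
    apply: measure_sigma_subadditive => //.
    - by move=> i; exact: borel_measurable_euclid.
    - by apply: borel_measurable_euclid; exact: bigcupT_measurable.
  by apply: lee_nneseries => // i _; rewrite lebesgueE.
pose G k := projT1 (cid (h k)).
have hG k := projT2 (cid (h k)).
have mG : measurable (\bigcap_k G k).
  by apply: bigcapT_measurable => k; have [] := hG k.
have XG : X `<=` \bigcap_k G k by move=> x Xx k _; have [_ +_] := hG k; apply.
exists (\bigcap_k G k); split => //.
have mGX := measurableD (borel_measurable_euclid mG) mX.
apply/negligibleP => //.
rewrite measureD//; last 2 first.
- exact: borel_measurable_euclid.
- have [mG0 XG0 le] := hG 0.
  apply: (@le_lt_trans _ _ (lebesgue R n (G 0))).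
    apply: le_measure; rewrite ?inE; [exact: borel_measurable_euclid..|].
    exact: bigcap_inf.
  by apply: le_lt_trans le _; rewrite lte_add_pinfty// ltry.
rewrite (setIidr XG) [X in (X - _)%E](_ : _ = lebesgue R n X) ?subee//.
apply/eqP; rewrite eq_le; apply/andP; split; last first.
  by rewrite le_measure ?inE//; exact: borel_measurable_euclid.
apply/lee_addgt0Pr => e e0.
have [k _ ke] := near_infty_natSinv_lt (PosNum e0).
have [mG0 XG0 le] := hG k.
apply: (@le_trans _ _ (lebesgue R n (G k))).
  apply: le_measure; rewrite ?inE; [exact: borel_measurable_euclid..|].
  exact: bigcap_inf.
apply: (le_trans le); rewrite leeD2l// lee_fin ltW//.
by have := ke k (leqnn k).
Qed.
End translation.

(** * Multipliers of an annihilator *)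

Section threshold.
Context {R : realType}.
Implicit Types y z : R.

Lemma bernoulli_pow z N : 0 <= z <= 1 -> 1 - N%:R * z <= (1 - z) ^+ N.
Proof.
move=> /andP[z0 z1]; elim: N => [|N ih]; first by rewrite mul0r subr0 expr0.
rewrite exprS; have h : 0 <= 1 - z by rewrite subr_ge0.
apply: le_trans (ler_wpM2l h ih); rewrite -natr1.
have : 0 <= N%:R * z ^+ 2 by rewrite mulr_ge0// sqr_ge0.
nra.
Qed.

(** Replace N z by (1 + z)^N, which dominates it, and use (1 - z^2)^N <= 1. *)
Lemma pow_inv_bernoulli z N : 0 <= z <= 1 -> (1 - z) ^+ N * (N%:R * z) <= 1.
Proof.
move=> /andP[z0 z1].
have h1 : 1 + N%:R * z <= (1 + z) ^+ N.
  elim: N => [|N ih]; first by rewrite mul0r addr0 expr0.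
  rewrite exprS; have h : 0 <= 1 + z by rewrite addr_ge0.
  apply: le_trans (ler_wpM2l h ih); rewrite -natr1.
  have : 0 <= N%:R * z ^+ 2 by rewrite mulr_ge0// sqr_ge0.
  nra.
have h2 : 0 <= (1 - z) ^+ N by rewrite exprn_ge0// subr_ge0.
apply: (@le_trans _ _ ((1 - z) ^+ N * (1 + z) ^+ N)).
  by rewrite ler_wpM2l// (le_trans _ h1)// lerDr.
rewrite -exprMn -subr_sqr expr1n exprn_ile1 ?subr_ge0//.
- by rewrite expr_le1.
- by rewrite lerBlDr lerDl sqr_ge0.
Qed.

(* Polynomials in [y], converging on [0, 1] to a step at 1/2 by Bernoulli's
   inequality. *)
Definition threshold_pol y n := (1 - y ^+ n) ^+ (2 ^ n).

Lemma threshold_pol_itv y n : 0 <= y <= 1 -> 0 <= threshold_pol y n <= 1.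
Proof.
move=> /andP[y0 y1]; rewrite /threshold_pol.
have yn : 0 <= 1 - y ^+ n <= 1.
  by rewrite subr_ge0 exprn_ile1//= lerBlDr lerDl exprn_ge0.
by move: yn => /andP[? ?]; rewrite exprn_ge0//= exprn_ile1.
Qed.

(** With z = y^n and N = 2^n, [bernoulli_pow] puts the value between 1 - (2y)^n and 1. *)
Lemma cvg_threshold_pol_lt y : 0 <= y < 2^-1 ->
  threshold_pol y n @[n --> \oo] --> (1 : R).
Proof.
move=> /andP[y0 y2].
have h0 : (2 * y) ^+ n @[n --> \oo] --> (0 : R).
  by apply: cvg_expr; rewrite ger0_norm ?mulr_ge0//; lra.
have h1 : 1 - (2 * y) ^+ n @[n --> \oo] --> (1 : R).
  by rewrite -[X in _ --> X]subr0; apply: cvgB => //; exact: cvg_cst.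
apply: (@squeeze_cvgr _ _ _ _ (fun n => 1 - (2 * y) ^+ n) (fun=> 1)
  _ _ 1 h1 (cvg_cst _)).
apply: nearW => n.
have yn : 0 <= y ^+ n <= 1 by rewrite exprn_ge0//= exprn_ile1//; lra.
have /(threshold_pol_itv n)/andP[_ ->] : 0 <= y <= 1 by lra.
by rewrite andbT; have := bernoulli_pow (2 ^ n) yn; rewrite natrX exprMn.
Qed.

(** Here [pow_inv_bernoulli] bounds the value by (2y)^-n. *)
Lemma cvg_threshold_pol_gt y : 2^-1 < y <= 1 ->
  threshold_pol y n @[n --> \oo] --> (0 : R).
Proof.
move=> /andP[y2 y1].
have y0 : 0 < y by lra.
have h0 : ((2 * y)^-1) ^+ n @[n --> \oo] --> (0 : R).
  have y20 : 0 < 2 * y by lra.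
  by apply: cvg_expr; rewrite gtr0_norm ?invr_gt0// invf_lt1//; lra.
apply: (@squeeze_cvgr _ _ _ _ (fun=> 0) (fun n => ((2 * y)^-1) ^+ n)
  _ _ 0 (cvg_cst _) h0).
apply: nearW => n.
have y0' := ltW y0.
have yn : 0 <= y ^+ n <= 1 by rewrite exprn_ge0 ?exprn_ile1.
have /(threshold_pol_itv n)/andP[-> _] /= : 0 <= y <= 1 by rewrite ltW.
have := pow_inv_bernoulli (2 ^ n) yn; rewrite natrX -exprMn -/(threshold_pol y n) => h.
by rewrite exprVn -[leRHS]mul1r ler_pdivlMr// exprn_gt0//; lra.
Qed.

Lemma half_sub_itv (e : R) : `|e| <= 1 -> 0 <= 2^-1 - e / 2 <= 1.
Proof. by rewrite ler_norml => /andP[? ?]; apply/andP; split; lra. Qed.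

Lemma lt_half_sub (e : R) : (2^-1 < 2^-1 - e / 2) = (e < 0).
Proof. by apply/idP/idP => ?; lra. Qed.

Lemma half_sub_lt (e : R) : (2^-1 - e / 2 < 2^-1) = (0 < e).
Proof. by apply/idP/idP => ?; lra. Qed.

End threshold.

(** * The algebra of multipliers and its sigma-algebra *)

Section multipliers.
Context d (T : measurableType d) {R : realType} (mu : {measure set T -> \bar R}).
Variables (D : set T) (mD : measurable D) (Doo : (mu D < +oo)%E).

Definition bounded_measurable (f : T -> R) :=
  measurable_fun setT f /\ exists M : R, forall x, `|f x| <= M.

Lemma bounded_measurable_integrable f :
  bounded_measurable f -> mu.-integrable D (EFin \o f).
Proof.
move=> [mf [M fM]]; apply: measurable_bounded_integrable => //.
  exact: measurable_funTS.
exists M; split; first exact: num_real.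
by move=> r Mr x _ /=; rewrite (le_trans (fM x))// ltW.
Qed.

Lemma bounded_measurable_cst c : bounded_measurable (cst c).
Proof. by split => //; exists `|c|. Qed.

Lemma bounded_measurableD f g : bounded_measurable f -> bounded_measurable g ->
  bounded_measurable (f \+ g).
Proof.
move=> [mf [M fM]] [mg [N gN]]; split; first exact: measurable_funD.
by exists (M + N) => x; rewrite (le_trans (ler_normD _ _))// lerD.
Qed.

Lemma bounded_measurableM f g : bounded_measurable f -> bounded_measurable g ->
  bounded_measurable (f \* g).
Proof.
move=> [mf [M fM]] [mg [N gN]]; split; first exact: measurable_funM.
by exists (M * N) => x; rewrite normrM ler_pM.
Qed.

Lemma bounded_measurable_lim M (f : (T -> R)^nat) g :
  (forall n, bounded_measurable (f n)) -> (forall n x, `|f n x| <= M) ->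
  (forall x, f n x @[n --> \oo] --> g x) -> bounded_measurable g.
Proof.
move=> mf fM fg; split.
  by apply: (@measurable_fun_cvg _ _ _ _ f) => // n; have [] := mf n.
exists M => x; rewrite -(cvg_lim _ (cvg_norm (fg x)))//.
apply: limr_le; first by apply/cvg_ex; exists `|g x|; apply: cvg_norm; exact: fg.
by apply: nearW => n; exact: fM.
Qed.

Variables (I : Type) (w : I -> T -> R).
Hypothesis bmw : forall i, bounded_measurable (w i).

(** The family [w] will consist of cosines and sines, so that the vanishing of complex Fourier
    coefficients becomes a family of real conditions. *)
Definition annihilated (f : T -> R) := bounded_measurable f /\
  forall i, \int[mu]_(x in D) (w i x * f x) = 0.

(* Multipliers form an algebra closed under bounded pointwise limits, hence the
   sets with multiplier indicators form a sigma-algebra. *)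
Definition multiplier (g : T -> R) := bounded_measurable g /\
  forall f, annihilated f -> annihilated (g \* f).

Lemma annihilatedD f g : annihilated f -> annihilated g -> annihilated (f \+ g).
Proof.
move=> [bf f0] [bg g0]; split; first exact: bounded_measurableD.
move=> i /=; under eq_Rintegral do rewrite mulrDr.
rewrite RintegralD ?f0 ?g0 ?addr0//;
  by apply: (@bounded_measurable_integrable (w i \* _)); exact: bounded_measurableM.
Qed.

(** Dominated convergence, with a constant majorant that is integrable because [D] has finite
    measure. *)
Lemma annihilated_lim M (f : (T -> R)^nat) g :
  (forall n, annihilated (f n)) -> (forall n x, `|f n x| <= M) ->
  (forall x, f n x @[n --> \oo] --> g x) -> annihilated g.
Proof.
move=> af fM fg.
have bg : bounded_measurable g.
  by apply: bounded_measurable_lim fM fg => n; case: (af n).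
split=> // i.
have [mw [N wN]] := bmw i.
have [_ _] : [/\ mu.-integrable D (EFin \o (w i \* g)),
    [sequence (\int[mu]_(x in D) `|(w i x * f n x)%:E - (w i x * g x)%:E|)%E]_n
      @ \oo --> (0 : \bar R)%E
  & [sequence (\int[mu]_(x in D) (w i x * f n x)%:E)%E]_n @ \oo -->
     (\int[mu]_(x in D) (w i x * g x)%:E)%E].
  apply: (@dominated_convergence _ _ _ mu D mD
      (fun n x => (w i x * f n x)%:E) _ (cst (N * M)%:E)).
  - move=> n; apply/measurable_EFinP; apply: measurable_funTS.
    by apply: measurable_funM => //; case: (af n) => -[].
  - apply/measurable_EFinP; apply: measurable_funTS.
    by apply: measurable_funM => //; case: bg.
  - apply: aeW => x _; apply: cvg_EFin; first exact: nearW.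
    by apply: cvgM; [exact: cvg_cst|exact: fg].
  - by apply/(@bounded_measurable_integrable (cst _))/bounded_measurable_cst.
  - by apply: aeW => x n _; rewrite lee_fin normrM ler_pM.
rewrite (_ : [sequence _]_n = cst 0%E); last first.
  apply/funext => n /=; have [bf f0] := af n.
  rewrite -[LHS]fineK; first by have := f0 i; rewrite /Rintegral => ->.
  apply: integrable_fin_num => //.
  by apply: (@bounded_measurable_integrable (w i \* f n)); exact: bounded_measurableM.
by move/(cvg_lim (@ereal_hausdorff R)); rewrite lim_cst// /Rintegral => <-.
Qed.

Lemma multiplier_cst c : multiplier (cst c).
Proof.
split=> [|f [bf f0]]; first exact: bounded_measurable_cst.
split=> [|i]; first exact/bounded_measurableM/bf/bounded_measurable_cst.
under eq_Rintegral do rewrite mulrCA.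
rewrite RintegralZl ?f0 ?mulr0//.
by apply: (@bounded_measurable_integrable (w i \* f)); exact: bounded_measurableM.
Qed.

Lemma multiplierM f g : multiplier f -> multiplier g -> multiplier (f \* g).
Proof.
move=> [bf mf] [bg mg]; split; first exact: bounded_measurableM.
move=> h /mg /mf; rewrite (_ : f \* (g \* h) = f \* g \* h)//.
by apply/funext => x /=; rewrite mulrA.
Qed.

Lemma multiplierD f g : multiplier f -> multiplier g -> multiplier (f \+ g).
Proof.
move=> [bf mf] [bg mg]; split; first exact: bounded_measurableD.
move=> h ah; rewrite (_ : _ \* h = (f \* h) \+ (g \* h)).
  by apply: annihilatedD; [exact: mf|exact: mg].
by apply/funext => x /=; rewrite mulrDl.
Qed.

Lemma multiplier_exp f n : multiplier f -> multiplier (fun x => f x ^+ n).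
Proof.
move=> mf; elim: n => [|n ih]; first exact: (multiplier_cst 1).
rewrite (_ : (fun x => _) = f \* (fun x => f x ^+ n)); first exact: multiplierM.
by apply/funext => x; rewrite /= exprS.
Qed.

Lemma multiplier_affine a b f : multiplier f -> multiplier (fun x => a + b * f x).
Proof.
move=> mf; apply: (@multiplierD (cst a) (cst b \* f)); first exact: multiplier_cst.
by apply: multiplierM => //; exact: multiplier_cst.
Qed.

Lemma multiplier_lim M (f : (T -> R)^nat) g :
  (forall n, multiplier (f n)) -> (forall n x, `|f n x| <= M) ->
  (forall x, f n x @[n --> \oo] --> g x) -> multiplier g.
Proof.
move=> mf fM fg; split.
  by apply: bounded_measurable_lim fM fg => n; case: (mf n).
move=> h ah; have [[_ [N hN]] _] := ah.
apply: (@annihilated_lim (M * N) (fun n => f n \* h)).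
- by move=> n; have [_] := mf n; exact.
- by move=> n x /=; rewrite normrM ler_pM.
- by move=> x /=; apply: cvgM => //; exact: cvg_cst.
Qed.

(** With [M] a bound for |f|, the powers of 1 - (f / (1 + M))^2 converge boundedly to the indicator:
    the base is 1 where [f] vanishes and lies in [0, 1[ elsewhere. *)
Lemma multiplier_eq0 f : multiplier f -> multiplier (\1_[set x | f x = 0]).
Proof.
move=> mf; have [[_ [M fM]] _] := mf.
have M0 (x : T) : 0 < 1 + M by rewrite ltr_pwDl// (le_trans _ (fM x)).
pose g x := 1 + -1 * ((0 + (1 + M)^-1 * f x) ^+ 2).
have g01 x : 0 <= g x <= 1 /\ (f x != 0 -> g x < 1).
  rewrite /g add0r mulN1r; split.
    rewrite subr_ge0 lerBlDr lerDl sqr_ge0 andbT -real_normK ?num_real//.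
    rewrite expr_le1// normrM normfV (ger0_norm (ltW (M0 x))).
    by rewrite ler_pdivrMl ?(M0 x)// mulr1 (le_trans (fM x))// lerDr.
  move=> fx; rewrite ltrBlDr ltrDl exprn_even_gt0//= mulf_neq0// invr_eq0.
  by rewrite gt_eqF ?(M0 x).
apply: (@multiplier_lim 1 (fun n x => g x ^+ n)).
- by move=> n; apply/multiplier_exp/multiplier_affine/multiplier_exp/multiplier_affine.
- by move=> n x; have [/andP[g0 g1] _] := g01 x;
    rewrite ger0_norm ?exprn_ge0// exprn_ile1.
- move=> x; rewrite indicE; have [fx|fx] := eqVneq (f x) 0.
    rewrite mem_set//= (_ : (fun n => _) = cst 1); first exact: cvg_cst.
    by apply/funext => n; rewrite /g fx mulr0 addr0 expr0n/= mulr0 addr0 expr1n.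
  rewrite memNset//=; last exact/eqP.
  apply: cvg_expr; have [/andP[g0 _] /(_ fx)] := g01 x.
  by rewrite ger0_norm.
Qed.

(* [threshold_pol] is not controlled at 1/2, that is where [f] vanishes; the
   factor [q] kills that set. *)
Lemma multiplier_gt0 f : multiplier f -> multiplier (\1_[set x | 0 < f x]).
Proof.
move=> mf; have [[_ [M fM]] _] := mf.
have M0 (x : T) : 0 < 1 + M by rewrite ltr_pwDl// (le_trans _ (fM x)).
(* This affine change maps the range of [f] into [0, 1] and turns 0 < f into y < 1/2. *)
pose y x : R := 2^-1 + (- (2 * (1 + M))^-1) * f x.
have yE x : exists2 e : R, y x = 2^-1 - e / 2 & [/\ `|e| <= 1, (0 < e) = (0 < f x) &
    (e == 0) = (f x == 0)].
  exists ((1 + M)^-1 * f x).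
    by rewrite /y invfM mulNr -mulrA [2^-1 * _]mulrC.
  rewrite normrM normfV (ger0_norm (ltW (M0 x))) ler_pdivrMl ?(M0 x)//.
  rewrite mulr1 (le_trans (fM x)) ?lerDr// pmulr_rgt0 ?invr_gt0 ?(M0 x)//.
  by rewrite mulf_eq0 invr_eq0 gt_eqF ?(M0 x).
have y01 x : 0 <= y x <= 1.
  by have [e -> [e1 _ _]] := yE x; exact: half_sub_itv.
pose q x : R := 1 + -1 * \1_[set x | f x = 0] x.
have q01 x : `|q x| <= 1.
  rewrite /q indicE; case: (_ \in _).
    by rewrite mulr1 subrr normr0.
  by rewrite mulr0 addr0 normr1.
apply: (@multiplier_lim 1 (fun n => q \* (fun x => threshold_pol (y x) n))).
- move=> n; apply: multiplierM; first exact/multiplier_affine/multiplier_eq0.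
  apply: (@multiplier_exp (fun x => _)).
  rewrite (_ : (fun x => _) = (fun x => 1 + -1 * (y x ^+ n))).
    exact/multiplier_affine/multiplier_exp/multiplier_affine.
  by apply/funext => x; rewrite mulN1r.
- move=> n x /=; rewrite normrM -[leRHS]mulr1 ler_pM//.
  by have /andP[h0 h1] := threshold_pol_itv n (y01 x); rewrite ger0_norm.
- move=> x /=; rewrite indicE.
  have [e ye [e1 e0 e00]] := yE x.
  have [fx|fx|fx] := ltgtP (f x) 0.
  + rewrite memNset /=; last by apply/negP; rewrite -leNgt ltW.
    rewrite -[X in _ --> X](mulr0 (q x)); apply: cvgM; first exact: cvg_cst.
    apply: cvg_threshold_pol_gt; have /andP[_ ->] := y01 x; rewrite andbT ye.
    by rewrite lt_half_sub lt_neqAle e00 lt_eqF//= leNgt e0 -leNgt ltW.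
  + rewrite mem_set//= -[X in _ --> X](mulr1 1); apply: cvgM.
      rewrite (_ : q x = 1); first exact: cvg_cst.
      by rewrite /q indicE memNset/= ?mulr0 ?addr0//; apply/eqP; rewrite gt_eqF.
    apply: cvg_threshold_pol_lt; have /andP[-> _] := y01 x; rewrite /= ye.
    by rewrite half_sub_lt e0.
  + rewrite memNset /= ?fx ?ltxx// (_ : (fun n => _) = cst 0); first exact: cvg_cst.
    by apply/funext => n; rewrite /q indicE mem_set//= mulr1 subrr mul0r.
Qed.

Definition multiplier_set (A : set T) := multiplier (\1_A).

(** Complements come from affine maps, intersections from products, and countable unions from
    bounded limits of the indicators of finite unions. *)
Lemma sigma_algebra_multiplier_set : sigma_algebra setT multiplier_set.
Proof.
have C A : multiplier_set A -> multiplier_set (~` A).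
  move=> mA; rewrite /multiplier_set (_ : \1_(~` A) = fun x => 1 + -1 * \1_A x :> R).
    exact: multiplier_affine.
  apply/funext => x; rewrite !indicE in_setC.
  by case: (x \in A); rewrite /= ?mulr1 ?subrr ?mulr0 ?addr0.
have In A B : multiplier_set A -> multiplier_set B -> multiplier_set (A `&` B).
  move=> mA mB; rewrite /multiplier_set indicI; exact: multiplierM.
have mset0 : multiplier_set set0.
  by rewrite /multiplier_set indic0; exact: multiplier_cst.
split=> // [A mA|A mA]; first by rewrite setTD; exact: C.
have U n : multiplier_set (\big[setU/set0]_(k < n) A k).
  elim: n => [|n ih]; first by rewrite big_ord0.
  by rewrite big_ord_recr/= -[_ `|` _]setCK setCU; apply/C/In; exact: C.
apply: (@multiplier_lim 1 (fun n => \1_(\big[setU/set0]_(k < n) A k))) => //.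
  by move=> n x; rewrite indicE; case: (_ \in _); rewrite ?normr1 ?normr0.
move=> x; rewrite indicE; have [[k _ Akx]|nA] := pselect ((\bigcup_k A k) x).
  rewrite mem_set; last by exists k.
  apply: cvg_near_cst; exists k.+1 => //= n /= kn.
  by rewrite indicE mem_set// -bigcup_mkord; exists k.
rewrite memNset//= (_ : (fun n => _) = cst 0); first exact: cvg_cst.
apply/funext => n; rewrite indicE memNset//= -bigcup_mkord => -[k _ Akx].
by apply: nA; exists k.
Qed.

(** As a type, the sigma-algebra of multiplier sets can be the domain of measurable functions, so
    that Borel operations on multipliers are covered by the general theory. *)
Definition multiplier_type := g_sigma_algebraType multiplier_set.

Lemma measurable_multiplier_type (A : set multiplier_type) :
  measurable A -> multiplier_set A.
Proof.
by rewrite /measurable/= (sigma_algebra_id sigma_algebra_multiplier_set).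
Qed.

(** The rays ]a, +oo[ generate the Borel sets, and the preimage of such a ray is the positivity set
    of the multiplier f - a. *)
Lemma measurable_fun_multiplier f : multiplier f ->
  measurable_fun [set: multiplier_type] (f : multiplier_type -> R).
Proof.
move=> mf; apply: (measurability _ (RGenOInfty.measurableE R)).
move=> _ [_ [a ->] <-]; rewrite setTI; apply: sub_sigma_algebra.
have := multiplier_gt0 (multiplier_affine (- a) 1 mf).
rewrite /multiplier_set; congr (multiplier \1_ _).
by apply/seteqP; split => x /=; rewrite in_itv/= andbT mul1r addrC subr_gt0.
Qed.

End multipliers.

(** * Fractional parts *)

Section fractional_part.
Context {R : realType}.
Implicit Types y t s : R.

Lemma periodic_int (f : R -> R) (p : R) : periodic f p ->
  forall (k : int) a, f (a + k%:~R * p) = f a.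
Proof.
move=> fp [n|n] a; first by rewrite -pmulrn mulr_natl periodicn.
by rewrite NegzE mulrNz mulNr -pmulrn mulr_natl -[in RHS](subrK (p *+ n.+1) a) periodicn.
Qed.

Lemma cos_2piD (t : R) (k : int) : cos (2 * pi * (t + k%:~R)) = cos (2 * pi * t).
Proof.
rewrite mulrDr -[RHS](periodic_int (@cosD2pi R) k) -(mulr_natl pi 2).
by rewrite [k%:~R * _]mulrC.
Qed.

Lemma sin_2piD (t : R) (k : int) : sin (2 * pi * (t + k%:~R)) = sin (2 * pi * t).
Proof.
rewrite mulrDr -[RHS](periodic_int (@sinD2pi R) k) -(mulr_natl pi 2).
by rewrite [k%:~R * _]mulrC.
Qed.

Definition fractional_part y := y - (Num.floor y)%:~R.

Lemma fractional_part_itv y : 0 <= fractional_part y < 1.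
Proof.
have /andP[h1 h2] := floor_itv y.
by rewrite subr_ge0 h1 ltrBlDl -[1](mulr1z (1 : R)) -intrD.
Qed.

Lemma two_pi_itv t : 0 <= t <= 2^-1 -> 2 * pi * t \in `[0, pi].
Proof.
move=> /andP[t0 t2]; have p0 := pi_gt0 R; rewrite in_itv/=; apply/andP; split.
  by rewrite !mulr_ge0 ?pi_ge0.
rewrite mulrAC ler_piMl ?pi_ge0//; lra.
Qed.

Lemma cos_2pi_lt t s : 0 <= t <= 2^-1 -> 0 <= s <= 2^-1 ->
  (cos (2 * pi * s) < cos (2 * pi * t)) = (t < s).
Proof.
move=> ht hs; rewrite ltr_cos ?two_pi_itv//.
by rewrite ltr_pM2l// mulr_gt0// pi_gt0.
Qed.

Lemma cos_2pi_1B t : cos (2 * pi * (1 - t)) = cos (2 * pi * t).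
Proof.
rewrite addrC -[1](mulr1z (1 : R)) (cos_2piD (- t) 1).
by rewrite mulrN cosN.
Qed.

Lemma sin_2pi_ge0 t : 0 <= t < 1 -> (0 <= sin (2 * pi * t)) = (t <= 2^-1).
Proof.
move=> /andP[t0 t1]; have [t2|t2] := leP t 2^-1.
  by rewrite sin_ge0_pi//; have := @two_pi_itv t; rewrite in_itv/= => ->//; rewrite t0.
apply/negbTE; rewrite -ltNge -(sin_2piD t (-1)) mulrN1z.
rewrite (_ : 2 * pi * (t - 1) = - (2 * pi * (1 - t))); last by ring.
have p0 := pi_gt0 R.
rewrite sinN oppr_lt0 sin_gt0_pi//; apply/andP; split.
  by rewrite !mulr_gt0// subr_gt0.
rewrite mulrAC gtr_pMl//; lra.
Qed.

(** In the application only the cosine and sine of 2 pi y are known to be multipliers. The sign of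
    the sine tells which half of [0, 1[ contains the fractional part, and on each half the cosine is
    strictly monotone. *)
Lemma measurable_fractional_part d (T : measurableType d) (y : T -> R) :
  measurable_fun setT (fun x => cos (2 * pi * y x)) ->
  measurable_fun setT (fun x => sin (2 * pi * y x)) ->
  measurable_fun setT (fun x => fractional_part (y x)).
Proof.
set t := fun x => fractional_part (y x).
have ty x : y x = t x + (Num.floor (y x))%:~R by rewrite subrK.
rewrite (_ : (fun x => cos _) = (fun x => cos (2 * pi * t x))); last first.
  by apply/funext => x; rewrite ty cos_2piD.
rewrite (_ : (fun x => sin _) = (fun x => sin (2 * pi * t x))); last first.
  by apply/funext => x; rewrite ty sin_2piD.
move=> mc ms; have t01 x : 0 <= t x < 1 := fractional_part_itv (y x).
have mS : measurable [set x | 0 <= sin (2 * pi * t x)].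
  rewrite -[X in measurable X]setTI.
  rewrite (_ : _ `&` _ = setT `&` (fun x => sin (2 * pi * t x)) @^-1` `[0, +oo[).
    exact: ms.
  by apply/seteqP; split => x /=; rewrite in_itv/= andbT.
apply: (measurability _ (RGenInftyO.measurableE R)) => _ [_ [s ->] <-].
rewrite setTI.
have [s0|s0] := leP s 0.
  rewrite (_ : _ @^-1` _ = set0)//; apply/seteqP; split=> x //=.
  by rewrite in_itv/= => ts; have := t01 x; rewrite leNgt (lt_le_trans ts).
(* On [0, 1/2] the cosine decreases, so the sublevel set is the first half cut by a superlevel set
   of the cosine. *)
have [s2|s2] := leP s 2^-1.
  rewrite (_ : _ @^-1` _ = [set x | 0 <= sin (2 * pi * t x)] `&`
      (fun x => cos (2 * pi * t x)) @^-1` `]cos (2 * pi * s), +oo[).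
    by apply: measurableI => //; rewrite -[X in measurable X]setTI; exact: mc.
  have s02 : 0 <= s <= 2^-1 by rewrite ltW.
  apply/seteqP; split=> x /=; rewrite !in_itv/= andbT sin_2pi_ge0//.
    move=> ts; have t2 : t x <= 2^-1 by rewrite (le_trans (ltW ts)).
    by rewrite cos_2pi_lt// t2 andbT; have /andP[] := t01 x.
  by move=> [t2]; rewrite cos_2pi_lt// t2 andbT; have /andP[] := t01 x.
have [s1|s1] := leP s 1; last first.
  rewrite (_ : _ @^-1` _ = setT)//; apply/seteqP; split=> x //= _.
  by rewrite in_itv/=; have /andP[_ /lt_trans] := t01 x; exact.
rewrite (_ : _ @^-1` _ = [set x | 0 <= sin (2 * pi * t x)] `|`
    (fun x => cos (2 * pi * t x)) @^-1` `]-oo, cos (2 * pi * s)[).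
  by apply: measurableU => //; rewrite -[X in measurable X]setTI; exact: mc.
(* Past 1/2 the reflection of t to 1 - t brings the cosine back to its decreasing branch. *)
have hs : 0 <= 1 - s <= 2^-1 by apply/andP; split; lra.
have key x : 2^-1 < t x -> (cos (2 * pi * t x) < cos (2 * pi * s)) = (t x < s).
  have /andP[t0 t1] := t01 x => t2.
  rewrite -(cos_2pi_1B s) -cos_2pi_1B cos_2pi_lt//; first by rewrite ltrD2l ltrN2.
  by apply/andP; split; [rewrite subr_ge0 ltW|clear -t2; lra].
apply/seteqP; split=> x /=; rewrite !in_itv/= sin_2pi_ge0//.
  by move=> ts; have [|t2] := leP (t x) 2^-1; [left|right; rewrite key].
by move=> [t2|]; [exact: le_lt_trans s2|
  have [t2 _|t2] := leP (t x) 2^-1; [exact: le_lt_trans s2|rewrite key]].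
Qed.

End fractional_part.

(** * A Fourier uniqueness theorem *)

Section euclid_measurability.
Context {R : realType}.

Lemma dotpDl n (u v x : 'cV[R]_n) : dotp (u + v) x = dotp u x + dotp v x.
Proof. by rewrite /dotp -big_split; apply: eq_bigr => i _; rewrite mxE mulrDl. Qed.

Lemma dotpNl n (u x : 'cV[R]_n) : dotp (- u) x = - dotp u x.
Proof. by rewrite /dotp -sumrN; apply: eq_bigr => i _; rewrite mxE mulNr. Qed.

Lemma dotp0l n (x : 'cV[R]_n) : dotp 0 x = 0.
Proof. by rewrite /dotp big1// => i _; rewrite mxE mul0r. Qed.

Lemma dotpE n (u x : 'cV[R]_n) : dotp u x = (u^T *m x) ord0 ord0.
Proof. by rewrite mxE; apply: eq_bigr => i _; rewrite mxE. Qed.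

Lemma dotp_mulmx n (M : 'M[R]_n) (u x : 'cV[R]_n) :
  dotp (M *m u) x = dotp u (M^T *m x).
Proof. by rewrite !dotpE trmx_mul mulmxA. Qed.

Lemma borel_measurable_fun_euclid n d (T : measurableType d)
    (f : 'cV[R]_n -> T) :
  measurable_fun setT f -> measurable_fun [set: euclid R n] f.
Proof.
move=> mf _ Y mY; apply: borel_measurable_euclid; exact: mf.
Qed.

Lemma measurable_dotp n (u : 'cV[R]_n) :
  measurable_fun [set: 'cV[R]_n] (dotp u).
Proof.
apply: measurable_sum => i.
by apply: measurable_funM => //; exact: measurable_coord.
Qed.

Lemma measurable_mulmx n m (M : 'M[R]_(m, n)) :
  measurable_fun [set: 'cV[R]_n] (mulmx M : 'cV[R]_n -> 'cV[R]_m).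
Proof.
apply: measurable_fun_cVP => i; under eq_fun do rewrite mxE.
apply: measurable_sum => j.
by apply: measurable_funM => //; exact: measurable_coord.
Qed.

Lemma bounded_measurable_wave n (f : R -> R) (b : 'cV[R]_n) :
  (forall x, `|f x| <= 1) -> measurable_fun setT f ->
  bounded_measurable (fun x : euclid R n => f (2 * pi * dotp b x)).
Proof.
move=> f1 mf; split; last by exists 1.
apply: borel_measurable_fun_euclid; apply: (measurableT_comp mf).
by apply: measurable_funM => //; exact: measurable_dotp.
Qed.

Lemma norm_cos_le1 (x : R) : `|cos x| <= 1.
Proof. by rewrite ler_norml cos_geN1 cos_le1. Qed.

Lemma norm_sin_le1 (x : R) : `|sin x| <= 1.
Proof. by rewrite ler_norml sin_geN1 sin_le1. Qed.

Lemma bounded_measurable_cos n (b : 'cV[R]_n) :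
  bounded_measurable (fun x : euclid R n => cos (2 * pi * dotp b x)).
Proof.
apply: bounded_measurable_wave; first exact: norm_cos_le1.
exact: continuous_measurable_fun (@continuous_cos R).
Qed.

Lemma bounded_measurable_sin n (b : 'cV[R]_n) :
  bounded_measurable (fun x : euclid R n => sin (2 * pi * dotp b x)).
Proof.
apply: bounded_measurable_wave; first exact: norm_sin_le1.
exact: continuous_measurable_fun (@continuous_sin R).
Qed.

Lemma negligible_bigcup_countType (I : countType) d (T : measurableType d)
    (mu : {measure set T -> \bar R}) (F : I -> set T) :
  (forall i, mu.-negligible (F i)) -> mu.-negligible (\bigcup_i F i).
Proof.
move=> F0.
apply: (@negligibleS _ _ _ _ (\bigcup_k (oapp F set0 (unpickle k)))).
  by move=> x [i _ Fi]; exists (pickle i) => //=; rewrite pickleK.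
apply: negligible_bigcup => k; case: (unpickle k) => [i|] //=.
exact: negligible_set0.
Qed.

End euclid_measurability.

Section multiplier_lincomb.
Context d (T : measurableType d) {R : realType} (mu : {measure set T -> \bar R}).
Variables (D : set T) (mD : measurable D) (Doo : (mu D < +oo)%E).
Variables (I : Type) (w : I -> T -> R).
Hypothesis bmw : forall i, bounded_measurable (w i).

(** The integrals that must vanish for g f are combinations of those that vanish for f. *)
Lemma multiplier_lincomb g : bounded_measurable g ->
  (forall i, exists j k a b,
    forall x, w i x * g x = a * w j x + b * w k x) ->
  multiplier mu D w g.
Proof.
move=> bg h; split=> // f [bf f0]; split; first exact: bounded_measurableM.
move=> i; have [j [k [a [b wE]]]] := h i.
rewrite (_ : (fun x => _) =
    fun x => a * (w j x * f x) + b * (w k x * f x)); last first.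
  by apply/funext => x /=; rewrite mulrA wE mulrDl !mulrA.
have iw l : mu.-integrable D (EFin \o (w l \* f)).
  by apply: bounded_measurable_integrable => //; exact: bounded_measurableM.
have iaw c l : mu.-integrable D (EFin \o (fun x => c * (w l x * f x))).
  apply: bounded_measurable_integrable => //.
  apply: (@bounded_measurableM _ _ _ (cst c) (w l \* f)).
    exact: bounded_measurable_cst.
  exact: bounded_measurableM.
rewrite RintegralD//.
rewrite (@RintegralZl _ _ _ _ _ (fun x => w j x * f x) a mD (iw j)).
rewrite (@RintegralZl _ _ _ _ _ (fun x => w k x * f x) b mD (iw k)).
by rewrite !f0 !mulr0 addr0.
Qed.

End multiplier_lincomb.

(** * Vanishing Fourier coefficients on a set that packs along the dual lattice *)

Section fourier_uniqueness.
Context {R : realType} (n : nat) (B : 'M[R]_n) (Bu : B \in unitmx) (b0 : 'cV[R]_n).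
Notation leb := (lebesgue R n).
Variables (E : set (euclid R n)) (mE : measurable E) (Eoo : (leb E < +oo)%E).

Let ints (k : 'cV[int]_n) : 'cV[R]_n := map_mx intr k.

(** The offset [b0] will be the fixed part [C z] of the frequencies; the boolean selects the real or
    the imaginary part. *)
Let w (p : 'cV[int]_n * bool) (x : euclid R n) : R :=
  let t := 2 * pi * dotp (b0 + B *m ints p.1) x in if p.2 then cos t else sin t.

Hypothesis cos0 : forall k : 'cV[int]_n,
  \int[leb]_(x in E) cos (2 * pi * dotp (b0 + B *m map_mx intr k) x) = 0.
Hypothesis sin0 : forall k : 'cV[int]_n,
  \int[leb]_(x in E) sin (2 * pi * dotp (b0 + B *m map_mx intr k) x) = 0.

(** Here [g] runs over the dual lattice of [B Z^n]: the translates of [E] along it are almost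
    disjoint. *)
Hypothesis E_pack : forall g : 'cV[R]_n, g != 0 ->
  (exists k : 'cV[int]_n, B^T *m g = map_mx intr k) ->
  leb.-negligible (E `&` [set x : 'cV[R]_n | E (x + g)]).

Let w0 p : \int[leb]_(x in E) w p x = 0.
Proof. by case: p => k []; [exact: cos0|exact: sin0]. Qed.

Let bmw p : bounded_measurable (w p).
Proof.
by case: p => k []; [exact: bounded_measurable_cos|exact: bounded_measurable_sin].
Qed.

(** Coordinates in which the dual lattice of [B Z^n] becomes [Z^n]. *)
Let y i (x : 'cV[R]_n) := (B^T *m x) i ord0.

Let yE i x : y i x = dotp (B *m delta_mx i ord0) x.
Proof.
rewrite dotp_mulmx /y /dotp (bigD1 i)//= big1 ?addr0.
  by rewrite [delta_mx _ _ _ _]mxE !eqxx mul1r.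
by move=> j ji; rewrite !mxE (negbTE ji) mul0r.
Qed.

Let phaseD i (k : 'cV[int]_n) x :
  dotp (b0 + B *m ints (k + delta_mx i ord0)) x = dotp (b0 + B *m ints k) x + y i x.
Proof.
rewrite yE -dotpDl -addrA -mulmxDr; congr (dotp (_ + _ *m _) _).
by apply/colP => j; rewrite !mxE rmorphD/=; case: eqP.
Qed.

Let phaseB i (k : 'cV[int]_n) x :
  dotp (b0 + B *m ints (k - delta_mx i ord0)) x = dotp (b0 + B *m ints k) x - y i x.
Proof.
by have := phaseD i (k - delta_mx i ord0) x; rewrite subrK => ->; rewrite addrK.
Qed.

(** By the product-to-sum formulas, multiplying by this cosine averages the waves of indices k + e_i
    and k - e_i. *)
Let multiplier_cos i : multiplier leb E w (fun x => cos (2 * pi * y i x)).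
Proof.
apply: multiplier_lincomb; [exact: mE|exact: Eoo|exact: bmw| |].
  under eq_fun do rewrite yE; exact: bounded_measurable_cos.
move=> [k b]; exists (k + delta_mx i ord0, b), (k - delta_mx i ord0, b), 2^-1, 2^-1.
move=> x; rewrite /w/= phaseD phaseB (mulrDr (2 * pi)) (mulrBr (2 * pi)).
by case: b => /=; rewrite !(cosB, sinB, cosD, sinD); field.
Qed.

Let multiplier_sin i : multiplier leb E w (fun x => sin (2 * pi * y i x)).
Proof.
apply: multiplier_lincomb; [exact: mE|exact: Eoo|exact: bmw| |].
  under eq_fun do rewrite yE; exact: bounded_measurable_sin.
move=> [k b].
(* Multiplication by a sine exchanges cosines and sines; the signs are those of the product-to-sum
   formulas for cos t sin s and sin t sin s. *)
exists (k + delta_mx i ord0, ~~ b), (k - delta_mx i ord0, ~~ b).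
exists (if b then 2^-1 else - 2^-1), (if b then - 2^-1 else 2^-1).
move=> x; rewrite /w/= phaseD phaseB (mulrDr (2 * pi)) (mulrBr (2 * pi)).
by case: b => /=; rewrite !(cosB, sinB, cosD, sinD); field.
Qed.

Let T := multiplier_type leb E w.

(* The representative in [cell z] of the class of [x] modulo the dual lattice;
   it depends on [x] only through fractional parts. *)
Let rep (z : 'cV[int]_n) (x : T) : 'cV[R]_n :=
  invmx B^T *m (ints z + \col_i fractional_part (y i x)).

(** Measurability is for the sigma-algebra of multiplier sets, so preimages of Borel sets under
    [rep z], which are invariant under the dual lattice, have multiplier indicators. *)
Let measurable_rep z : measurable_fun [set: T] (rep z).
Proof.
apply: (measurableT_comp (measurable_mulmx (invmx B^T))).
apply: measurable_fun_cVP => i; under eq_fun do rewrite mxE.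
apply: measurable_funD; first exact: measurable_cst.
under eq_fun do rewrite mxE.
by apply: measurable_fractional_part; exact: measurable_fun_multiplier.
Qed.

Let cell (z : 'cV[int]_n) : set 'cV[R]_n :=
  [set x | forall i, (z i ord0)%:~R <= y i x < (z i ord0 + 1)%:~R].

Let measurable_cell z : measurable (cell z).
Proof.
rewrite (_ : cell z = \bigcap_(i in [set: 'I_n])
    (mulmx B^T @^-1` ((fun v : 'cV[R]_n => v i ord0) @^-1`
      `[(z i ord0)%:~R, (z i ord0 + 1)%:~R[%classic))); last first.
  apply/seteqP; split => x /= h i; first by move=> _; rewrite /= in_itv/=; exact: h.
  by have := h i I; rewrite /= in_itv.
apply: fin_bigcap_measurable => // i _; rewrite -[X in measurable X]setTI.
apply: measurable_mulmx => //; rewrite -[X in measurable X]setTI.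
exact: measurable_coord.
Qed.

Let BTu : B^T \in unitmx. Proof. by rewrite unitmx_tr. Qed.

Let rep_shift z x :
  rep z x = x + invmx B^T *m ints (z - \col_i Num.floor (y i x)).
Proof.
rewrite /rep -[X in _ = X + _](mulKmx BTu) -mulmxDr; congr (_ *m _).
apply/colP => i; rewrite !mxE rmorphB/= /fractional_part /y !mxE.
by rewrite addrCA.
Qed.

Let rep_cell z x : cell z x -> rep z x = x.
Proof.
move=> zx; rewrite rep_shift (_ : z - _ = 0).
  by rewrite /ints map_mx0 mulmx0 addr0.
by apply/colP => i; rewrite !mxE (@floor_def _ _ (z i ord0)) ?subrr//; exact: zx.
Qed.

Let multiplier_set_rep z G : measurable G ->
  multiplier_set leb E w (rep z @^-1` G).
Proof.
move=> mG; apply: measurable_multiplier_type => //; rewrite -[X in measurable X]setTI.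
exact: measurable_rep.
Qed.

(** The constant 1 is annihilated by [cos0] and [sin0], hence so is its product with the indicator
    of [H]. *)
Let integral_multiplier_set H p : multiplier_set leb E w H ->
  \int[leb]_(x in E) (w p x * \1_H x) = 0.
Proof.
move=> mH.
have [_] : annihilated leb E w (\1_H \* cst 1).
  apply: mH.2; split; first exact: bounded_measurable_cst.
  by move=> q; rewrite -(w0 q); apply: eq_Rintegral => x _; rewrite mulr1.
by move=> /(_ p) <-; apply: eq_Rintegral => x _; rewrite /= mulr1.
Qed.

(* Such a point either has a translate in [G `\` F], or lies in [E] together
   with a nontrivial translate, which [E_pack] excludes almost everywhere. *)
Let negligible_rep z (F G : set 'cV[R]_n) : F `<=` E `&` cell z ->
  leb.-negligible (G `\` F) ->
  leb.-negligible ((E `&` rep z @^-1` (G `&` cell z)) `\` F).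
Proof.
move=> FE GF.
pose g (k : 'cV[int]_n) := invmx B^T *m ints k.
have Bg k : B^T *m g k = ints k by rewrite /g mulKVmx.
pose bad k := (fun x : 'cV[R]_n => x + g k) @^-1` (G `\` F) `|`
   (if g k == 0 then set0 else E `&` [set x : 'cV[R]_n | E (x + g k)]).
have : leb.-negligible (\bigcup_k bad k).
  apply: negligible_bigcup_countType => k; apply: negligibleU.
    exact: negligible_shift.
  case: ifPn => [_|gk]; first exact: negligible_set0.
  by apply: E_pack => //; exists k; rewrite Bg.
apply: negligibleS => x [[Ex [Gx cx]] nFx].
have := rep_shift z x; set k := z - _; rewrite -/(g k) => rx.
exists k => //; rewrite /bad; have [k0|k0] := eqVneq (g k) 0.
  by left; split; rewrite /= k0 addr0//; move: Gx; rewrite rx k0 addr0.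
rewrite rx in Gx cx.
have [Frx|Frx] := pselect (F (x + g k)); last by left.
by right; split => //; exact: (FE _ Frx).1.
Qed.

(** Cut a Borel hull of [F] by the cell and take its preimage under [rep z]: this is a multiplier
    set whose trace on [E] coincides with [F] up to a null set. *)
Let integral_cell0 z F p : measurable F -> F `<=` E `&` cell z ->
  \int[leb]_(x in F) w p x = 0.
Proof.
move=> mF FE.
have Foo : (leb F < +oo)%E.
  by apply: le_lt_trans Eoo; apply: le_measure; rewrite ?inE// => x /FE[].
have [G [mG FG GF]] := borel_hull mF Foo.
have mH := multiplier_set_rep z (measurableI _ _ mG (measurable_cell z)).
rewrite -(integral_multiplier_set p mH).
have FH : F `<=` rep z @^-1` (G `&` cell z).
  move=> x Fx; have [_ cx] := FE _ Fx.
  by rewrite /preimage/= rep_cell//; split=> //; exact: FG.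
have NF := negligible_rep FE GF.
move: (rep z @^-1` _) mH FH NF => H [[mH _] _] FH NF.
have EF : E `&` F = F by apply/setIidr => x /FE[].
rewrite -[in LHS]EF Rintegral_mkcondr /Rintegral; congr fine.
have mw := (bmw p).1.
apply: (@ae_eq_integral _ _ _ leb E
  (fun x => (w p x * \1_H x)%:E)
  (fun x => ((w p \_ F) x)%:E)).
- exact: mE.
- apply/measurable_EFinP; apply: measurable_funTS.
  by apply/(measurable_restrictT _ mF)/measurable_funTS.
- apply/measurable_EFinP; apply: measurable_funTS.
  by apply: measurable_funM; [exact: mw|exact: mH].
apply: negligibleS NF => x /= /not_implyP[Ex].
move=> neq; split; last first.
  by move=> Fx; apply: neq; rewrite patchE mem_set// indicE mem_set ?mulr1//; exact: FH.
split=> //; apply: contrapT => nHx; apply: neq.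
rewrite patchE memNset; last by move=> /FH.
by rewrite indicE memNset ?mulr0.
Qed.

(** Inside a cell the wave of frequency [b0] integrates to 0 over every measurable part of [E], so
    its cosine and sine vanish almost everywhere there; as their squares sum to 1, the piece is
    null. Countably many cells cover the space. *)
Lemma fourier_packing_null : leb E = 0.
Proof.
apply: measure_negligible => //.
have : leb.-negligible (\bigcup_z (E `&` cell z)).
  apply: negligible_bigcup_countType => z.
  have mD : measurable (E `&` cell z : set (euclid R n)).
    by apply: measurableI => //; exact: borel_measurable_euclid.
  have wz p : ae_eq leb (E `&` cell z) (EFin \o w (0, p)) (cst 0%E).
    have iw D : measurable D -> D `<=` E `&` cell z ->
        leb.-integrable D (EFin \o w (0, p)).
      move=> mD' D'E; apply: bounded_measurable_integrable => //.
      by apply: le_lt_trans Eoo; apply: le_measure; rewrite ?inE// => x /D'E[].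
    apply: (@integral_ae_eq _ _ _ leb _ mD).
    - exact: iw.
    - exact: measurable_cst.
    - move=> F FD mF; rewrite integral0.
      have := @integral_cell0 z F (0, p) mF FD.
      rewrite /Rintegral => h; rewrite -[LHS]fineK ?h//.
      by apply: integrable_fin_num; [exact: mF|exact: iw].
  have : leb.-negligible (~` [set x | (E `&` cell z) x -> (w (0, true) x)%:E = 0%E] `|`
     ~` [set x | (E `&` cell z) x -> (w (0, false) x)%:E = 0%E]).
    by apply: negligibleU; exact: wz.
  apply: negligibleS => x Dx /=; apply: contrapT => /not_orP[/contrapT + /contrapT].
  move=> /(_ Dx)[c0] /(_ Dx)[s0].
  have := cos2Dsin2 (2 * pi * dotp (b0 + B *m ints 0) x).
  rewrite -[cos _]/(w (0, true) x) -[sin _]/(w (0, false) x) c0 s0.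
  rewrite expr0n/= addr0 => /eqP.
  by rewrite eq_sym oner_eq0.
apply: negligibleS => x Ex; exists (\col_i Num.floor (y i x)) => //; split => //= i.
by rewrite mxE; exact: floor_itv.
Qed.

End fourier_uniqueness.

(** * Lattices *)

Section lattices.
Context {R : realType} (d : nat).
Implicit Types (A B : 'M[R]_d).

Lemma map_intr_inj m n : injective (map_mx intr : 'M[int]_(m, n) -> 'M[R]_(m, n)).
Proof.
move=> M N /matrixP MN; apply/matrixP => i j.
by have := MN i j; rewrite !mxE => /intr_inj.
Qed.

Lemma countable_lattice n (M : 'M[R]_n) : countable (lattice M).
Proof. exact: card_le_trans (card_image_le _ _) (countableP _). Qed.

Lemma integral_pairing A B : A^T *m B \is a mxOver Num.int ->
  exists P : 'M[int]_d, A^T *m B = map_mx intr P.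
Proof.
move=> /mxOverP h; exists (\matrix_(i, j) Num.floor ((A^T *m B) i j)).
by apply/matrixP => i j; rewrite !mxE floorK//; have := h i j; rewrite mxE.
Qed.

Section unimodular.
Variables (A B : 'M[R]_d) (P : 'M[int]_d).
Hypotheses (Bu : B \in unitmx) (AB : A^T *m B = map_mx intr P).
Hypothesis det_AB : `|\det (A *m B)| = 1.

Lemma trmx_mul_int : B^T *m A = map_mx intr P^T.
Proof. by rewrite -map_trmx -AB trmx_mul trmxK. Qed.

Lemma unimodular_pairing : P^T \in unitmx.
Proof.
rewrite unitmx_tr unitmxE.
have : `|\det (map_mx intr P : 'M[R]_d)| = 1.
  by rewrite -AB det_mulmx det_tr -det_mulmx.
rewrite det_map_mx -intr_norm => /(@intr_inj R _ 1).
case: (\det P) => [[|[|n]]|[|n]] //.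
Qed.

(** As [B^T A] is the transpose of [P], inverting it over the integers turns dual-lattice
    coordinates into integer coordinates along [A]. *)
Lemma dual_lattice_int (g : 'cV[R]_d) (k : 'cV[int]_d) :
  B^T *m g = map_mx intr k -> g = A *m map_mx intr (invmx P^T *m k).
Proof.
move=> gk; apply: (can_inj (mulKmx (_ : B^T \in unitmx))); rewrite ?unitmx_tr// gk.
by rewrite mulmxA trmx_mul_int -map_mxM mulKVmx// unimodular_pairing.
Qed.

Lemma lattice_dual : lattice A = lattice (invmx B)^T.
Proof.
have Btu : B^T \in unitmx by rewrite unitmx_tr.
apply/seteqP; split => [_ [k _ <-]|_ [k _ <-]].
  exists (P^T *m k) => //; rewrite map_mxM -trmx_mul_int trmx_inv -mulmxA mulKmx//.
have Bk : B^T *m ((invmx B)^T *m map_mx intr k) = map_mx intr k.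
  by rewrite trmx_inv mulKVmx.
by rewrite (dual_lattice_int Bk); eexists.
Qed.

End unimodular.

End lattices.

(** * Squared lengths of integer vectors *)

Section sqnorm.
Context {d : nat}.
Implicit Types k z : 'cV[int]_d.

(** Natural-valued, so that a vector of maximal length can be extracted from a bounded set of
    naturals. *)
Definition sqnorm z : nat := `|(\sum_(i < d) z i ord0 ^+ 2)%R|%N.

Lemma sqnormE z : sqnorm z = \sum_(i < d) z i ord0 ^+ 2 :> int.
Proof. by rewrite /sqnorm gez0_abs// sumr_ge0// => i _; exact: sqr_ge0. Qed.

Lemma sqnorm_eq0 z : (sqnorm z == 0)%N = (z == 0).
Proof.
apply/eqP/eqP => [z0|->]; last first.
  by rewrite /sqnorm big1// => i _; rewrite mxE expr0n.
apply/colP => i; rewrite mxE; apply/eqP; rewrite -sqrf_eq0.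
have := sqnormE z; rewrite z0 => /esym/eqP; rewrite psumr_eq0; last first.
  by move=> j _; exact: sqr_ge0.
by move=> /allP/(_ i (mem_index_enum _)).
Qed.

Lemma sqnorm_parallelogram z k :
  (sqnorm (z + k) + sqnorm (z - k) = (sqnorm z).*2 + (sqnorm k).*2)%N.
Proof.
rewrite -!addnn; apply/eqP; rewrite -eqz_nat !PoszD !sqnormE -!big_split/=.
by apply/eqP/eq_bigr => i _; rewrite !mxE; ring.
Qed.

Lemma sqnorm_lt z k : k != 0 ->
  (sqnorm z < sqnorm (z + k))%N \/ (sqnorm z < sqnorm (z - k))%N.
Proof.
rewrite -sqnorm_eq0 -lt0n => k0; have := sqnorm_parallelogram z k.
by case: (ltnP (sqnorm z) (sqnorm (z + k))); [left|right; lia].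
Qed.

End sqnorm.

(** * Bounded sets and their lattice overlaps *)

Section bounded.
Context {R : realType} (d : nat) (K : set 'cV[R]_d).
Hypothesis K_bounded : bounded_set K.

Lemma bounded_set_coord :
  exists2 M : R, 0 <= M & forall x, K x -> forall i, `|x i ord0| <= M.
Proof.
(* Boundedness provides a norm bound by every real beyond [N]; this choice is also nonnegative. *)
have [N [_ /(_ (Num.max N 0 + 1))]] := K_bounded.
rewrite ltr_pwDr ?le_max ?lexx// => /(_ isT) KN.
exists (Num.max N 0 + 1) => [|x Kx i]; first by rewrite addr_ge0 ?le_max ?lexx ?orbT.
apply: le_trans (KN _ Kx); rewrite [leRHS]mx_normrE.
exact: (le_bigmax _ (fun ij => `|x ij.1 ij.2|) (i, ord0)).
Qed.

Lemma bounded_lebesgue_lty : measurable (K : set (euclid R d)) ->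
  (lebesgue R d K < +oo)%E.
Proof.
move=> mK; have [M M0 KM] := bounded_set_coord.
pose B : set 'cV[R]_d := [set v | forall i,
  v i ord0 \in `[(const_mx (- M) : 'cV_d) i ord0, (const_mx M : 'cV_d) i ord0]].
have mB : measurable B.
  rewrite (_ : B = \bigcap_(i in [set: 'I_d])
      ((fun v : 'cV[R]_d => v i ord0) @^-1` `[- M, M]%classic)); last first.
    by apply/seteqP; split => v h i; [move=> _|]; have := h i; rewrite !mxE//; exact.
  apply: fin_bigcap_measurable => // i _; rewrite -[X in measurable X]setTI.
  exact: measurable_coord.
have Boo : (lebesgue R d B < +oo)%E.
  rewrite lebesgueE//.
  have := @borel_lebesgue_box R d (const_mx (- M)) (const_mx M).
  rewrite -/B => ->; first exact: ltry.
  by move=> i; rewrite !mxE (le_trans _ M0)// oppr_le0.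
apply: le_lt_trans Boo; apply: le_measure; rewrite ?inE//.
  exact: borel_measurable_euclid.
by move=> x Kx i; rewrite !mxE in_itv/= -ler_norml; exact: KM.
Qed.

(** Since z = A^-1 (x - (x - A z)) with both points in [K], the coordinates of z are bounded in
    terms of A^-1 and the size of [K]. *)
Lemma bounded_lattice_overlap (A : 'M[R]_d) : A \in unitmx ->
  exists N : nat, forall z : 'cV[int]_d,
    (exists x, K x /\ K (x - A *m map_mx intr z)) -> (sqnorm z <= N)%N.
Proof.
move=> Au; have [M M0 KM] := bounded_set_coord.
pose L : R := \sum_i (\sum_j `|invmx A i j| * (M + M)) ^+ 2.
have L0 : 0 <= L by apply: sumr_ge0 => i _; exact: sqr_ge0.
exists `|Num.floor L|%N => z [x [Kx Kxz]].
have zL : (sqnorm z)%:R <= L.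
  rewrite pmulrn sqnormE rmorph_sum/=; apply: ler_sum => i _.
  rewrite rmorphXn/= -real_normK ?num_real//.
  rewrite lerXn2r ?nnegrE//.
    by rewrite sumr_ge0// => j _; rewrite mulr_ge0// addr_ge0.
  have -> : (z i ord0)%:~R = (invmx A *m (x - (x - A *m map_mx intr z))) i ord0 :> R.
    by rewrite opprB addrC subrK mulKmx// mxE.
  rewrite mxE (le_trans (ler_norm_sum _ _ _))//; apply: ler_sum => j _.
  rewrite normrM ler_wpM2l// !mxE (le_trans (ler_normB _ _))// lerD//; first exact: KM.
  by have := KM _ Kxz j; rewrite !mxE.
rewrite -lez_nat gez0_abs ?floor_ge0//.
by rewrite floor_ge_int -pmulrn.
Qed.

End bounded.

(** * Gabor bases of indicator functions *)

Local Open Scope complex_scope.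

Section complex_measurable.
Context {R : realType} {n : nat}.
Implicit Types (D : set (euclid R n)) (f g : euclid R n -> R[i]).

Definition measurable_ReIm D f :=
  measurable_fun D (fun x => complex.Re (f x)) /\
  measurable_fun D (fun x => complex.Im (f x)).

Lemma measurable_ReIm_cst D z : measurable_ReIm D (fun=> z).
Proof. by split; exact: measurable_cst. Qed.

Lemma measurable_ReImD D f g : measurable_ReIm D f -> measurable_ReIm D g ->
  measurable_ReIm D (fun x => f x + g x).
Proof.
move=> [Rf If] [Rg Ig]; split.
  rewrite (_ : (fun x => _) = fun x => complex.Re (f x) + complex.Re (g x)).
    exact: measurable_funD.
  by apply/funext => x; case: (f x) (g x) => ? ? [].
rewrite (_ : (fun x => _) = fun x => complex.Im (f x) + complex.Im (g x)).
  exact: measurable_funD.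
by apply/funext => x; case: (f x) (g x) => ? ? [].
Qed.

Lemma measurable_ReImZ D z f : measurable_ReIm D f ->
  measurable_ReIm D (fun x => z * f x).
Proof.
case: z => a b [Rf If]; split.
  rewrite (_ : (fun x => _) = fun x => a * complex.Re (f x) - b * complex.Im (f x)).
    by apply: measurable_funB; apply: measurable_funM => //; exact: measurable_cst.
  by apply/funext => x; case: (f x).
rewrite (_ : (fun x => _) = fun x => a * complex.Im (f x) + b * complex.Re (f x)).
  by apply: measurable_funD; apply: measurable_funM => //; exact: measurable_cst.
by apply/funext => x; case: (f x).
Qed.

Lemma measurable_ReIm_sum D (I : Type) (s : seq I) (z : I -> R[i])
    (f : I -> euclid R n -> R[i]) : (forall i, measurable_ReIm D (f i)) ->
  measurable_ReIm D (fun x => \sum_(i <- s) z i * f i x).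
Proof.
move=> mf; elim: s => [|i s ih].
  by under eq_fun do rewrite big_nil; exact: measurable_ReIm_cst.
under eq_fun do rewrite big_cons.
by apply: measurable_ReImD; [apply: measurable_ReImZ; exact: mf|exact: ih].
Qed.

Lemma Re_sqr_norm (z : R[i]) :
  complex.Re (`|z| ^+ 2) = complex.Re z ^+ 2 + complex.Im z ^+ 2.
Proof. by rewrite -add_Re2_Im2. Qed.

Lemma Re_sqr_norm_ge0 (z : R[i]) : 0 <= complex.Re (`|z| ^+ 2).
Proof. by rewrite Re_sqr_norm addr_ge0// sqr_ge0. Qed.

Lemma measurable_sqdist D f g : measurable_ReIm D f -> measurable_ReIm D g ->
  measurable_fun D (fun x => (complex.Re (`|f x - g x| ^+ 2))%:E).
Proof.
move=> mf mg.
have [Rf If] : measurable_ReIm D (fun x => f x - g x).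
  under eq_fun do rewrite -mulN1r.
  by apply: measurable_ReImD; [exact: mf|apply: measurable_ReImZ; exact: mg].
apply/measurable_EFinP.
under eq_fun do rewrite Re_sqr_norm.
by apply: measurable_funD; exact: measurable_funX.
Qed.

Lemma L2_restrict D f : measurable D -> L2 D f -> L2 setT (patch (fun=> 0) D f).
Proof.
move=> mD [Rf If foo].
have h (p : R[i] -> R) : p 0 = 0 -> (fun x => p (patch (fun=> 0) D f x)) = (p \o f) \_ D.
  by move=> p0; apply/funext => x; rewrite /patch; case: ifP => _ //=; rewrite p0.
split.
- by rewrite (h (@complex.Re R))//; apply/(measurable_restrictT _ mD).
- by rewrite (h (@complex.Im R))//; apply/(measurable_restrictT _ mD).
- rewrite (_ : L2dist2 _ _ _ = L2dist2 D f (fun=> 0))//.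
  rewrite /L2dist2 [RHS]integral_mkcond; apply: eq_integral => x _.
  rewrite /patch; case: ifP => // _.
  by rewrite subr0 normr0 expr0n.
Qed.

End complex_measurable.

(** * Gabor bases along a block-triangular lattice *)

Section gabor_lattice.
Context {R : realType} (d : nat) (A B C : 'M[R]_d) (K : set (euclid R d)).
Notation leb := (lebesgue R d).
Notation ints k := (map_mx intr k : 'cV[R]_d).
Hypotheses (Au : A \in unitmx) (Bu : B \in unitmx).
Hypotheses (mK : measurable K) (K0 : (0 < leb K)%E) (Koo : (leb K < +oo)%E).

Let L := lattice (block_mx A 0 C B).
Hypothesis K_gabor : gabor_orthonormal_basis (normalized_indic K) L.

Let c : R := (Num.sqrt (fine (leb K)))^-1.

Let c0 : c != 0.
Proof. by rewrite invr_eq0 sqrtr_eq0 -ltNge fine_gt0// K0 Koo. Qed.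

Lemma lattice_block (z k : 'cV[int]_d) :
  L (col_mx (A *m ints z) (C *m ints z + B *m ints k)).
Proof.
exists (col_mx z k) => //.
by rewrite map_col_mx mul_block_col mul0mx addr0.
Qed.

Lemma lattice_blockP l : L l -> exists z k : 'cV[int]_d,
  l = col_mx (A *m ints z) (C *m ints z + B *m ints k).
Proof.
move=> [u _ <-]; exists (usubmx u), (dsubmx u).
by rewrite -[in LHS](vsubmxK u) map_col_mx mul_block_col mul0mx addr0.
Qed.

Lemma gabor_atomE (a b : 'cV[R]_d) (x : euclid R d) :
  gabor_atom (normalized_indic K) (col_mx a b) x =
  (c * \1_K ((x : 'cV[R]_d) - a) * cos (2 * pi * dotp b x)) +i*
  (c * \1_K ((x : 'cV[R]_d) - a) * sin (2 * pi * dotp b x)).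
Proof.
rewrite /gabor_atom col_mxKu col_mxKd /plane_wave /normalized_indic -/c.
by simpc; rewrite ![_ * (c * _)]mulrC.
Qed.

(** The common support of the atoms with translations [A z] and 0. *)
Definition overlap (z : 'cV[int]_d) : set (euclid R d) :=
  K `&` [set x : 'cV[R]_d | K (x - A *m ints z)].

Lemma overlap0 : overlap 0 = K.
Proof.
by apply/seteqP; split => [x []//|x Kx]; split => //=;
  rewrite map_mx0 mulmx0 subr0.
Qed.

Lemma measurable_overlap z : measurable (overlap z).
Proof. by apply: measurableI => //; exact: measurable_euclid_shift. Qed.

Lemma overlap_lty z : (leb (overlap z) < +oo)%E.
Proof.
apply: le_lt_trans Koo; apply: le_measure; rewrite ?inE//.
  exact: measurable_overlap.
exact: subIsetl.
Qed.

(** Up to the factor [c ^+ 2], these are the real and imaginary parts of the inner product of an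
    atom with the atom at the origin; invertibility of [A] and [B] makes the two parameters
    distinct. *)
Lemma overlap_orthogonal z k : (z != 0) || (k != 0) ->
  \int[leb]_(x in overlap z) cos (2 * pi * dotp (C *m ints z + B *m ints k) x) = 0 /\
  \int[leb]_(x in overlap z) sin (2 * pi * dotp (C *m ints z + B *m ints k) x) = 0.
Proof.
move=> zk; set b := C *m _ + _.
have [_ _ [[_ _ orth _] _]] := K_gabor.
have L0 : L (col_mx 0 0).
  by have := lattice_block 0 0; rewrite !map_mx0 !mulmx0 addr0.
have neq : col_mx (A *m ints z) b <> col_mx 0 0.
  move=> /eq_col_mx[Az0 b0]; move: zk.
  have z0 : z = 0.
    apply: (@map_intr_inj R); rewrite map_mx0.
    by rewrite -[LHS](mulKmx Au) Az0 mulmx0.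
  rewrite z0 eqxx/= => /eqP; apply; apply: (@map_intr_inj R); rewrite map_mx0.
  move: b0; rewrite /b z0 map_mx0 mulmx0 add0r => b0.
  by rewrite -[LHS](mulKmx Bu) b0 mulmx0.
have := orth _ _ (lattice_block z k) L0 neq.
have inE x : gabor_atom (normalized_indic K) (col_mx (A *m ints z) b) x *
    (gabor_atom (normalized_indic K) (col_mx 0 0) x)^* =
    (c ^+ 2 * (\1_(overlap z) x * cos (2 * pi * dotp b x))) +i*
    (c ^+ 2 * (\1_(overlap z) x * sin (2 * pi * dotp b x))).
  rewrite !gabor_atomE dotp0l mulr0 cos0 sin0 !subr0 indicI /=.
  rewrite (_ : \1_[set x | K (x - A *m ints z)] x = \1_K (x - A *m ints z) :> R)//.
  by simpc; congr (_ +i* _); ring.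
have key (f : euclid R d -> R) : bounded_measurable f ->
    \int[leb]_x (c ^+ 2 * (\1_(overlap z) x * f x)) =
    c ^+ 2 * \int[leb]_(x in overlap z) f x.
  move=> [mf [M fM]].
  have fi : leb.-integrable (overlap z) (EFin \o f).
    apply: bounded_measurable_integrable; [exact: measurable_overlap|
      exact: overlap_lty|split; [exact: mf|by exists M]].
  rewrite -RintegralZl//; last exact: measurable_overlap.
  rewrite [RHS]Rintegral_mkcond; apply: eq_Rintegral => x _.
  rewrite patchE indicE; case: ifPn => _; by rewrite ?mul1r// mul0r mulr0.
rewrite /inner_L2 /complex_integral.
under eq_Rintegral do rewrite inE /=.
under [X in _ +i* X = _ -> _]eq_Rintegral do rewrite inE /=.
rewrite (key _ (bounded_measurable_cos b)) (key _ (bounded_measurable_sin b)).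
move=> [/eqP + /eqP]; rewrite !mulf_eq0 !(negbTE c0)/=.
by move=> /eqP -> /eqP ->.
Qed.

Hypothesis K_bounded : bounded_set (K : set 'cV[R]_d).
Variable P : 'M[int]_d.
Hypothesis AB : A^T *m B = map_mx intr P.
Hypothesis det_AB : `|\det (A *m B)| = 1.

(* If [z] is a nonzero vector of maximal length whose overlap is not null, then
   by the parallelogram law every nontrivial translate of [overlap z] is
   disjoint from it up to a null set. *)
Lemma overlap_null z : z != 0 -> leb.-negligible (overlap z).
Proof.
move=> z0; apply: contrapT => nz0.
pose S z := z != 0 /\ ~ leb.-negligible (overlap z).
have [N hN] := bounded_lattice_overlap K_bounded Au.
have SN y : S y -> (sqnorm y <= N)%N.
  move=> [_ ny]; apply: hN; apply: contrapT => h; apply: ny.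
  rewrite (_ : overlap y = set0); first exact: negligible_set0.
  by apply/seteqP; split => // x [Kx Kxy]; apply: h; exists x.
(* The squared lengths attained in [S] are bounded by [N], hence have a maximum. *)
pose T m := `[< exists2 y, S y & sqnorm y = m >].
have exT : exists m, T m by exists (sqnorm z); apply/asboolP; exists z.
have bT m : T m -> (m <= N)%N by move=> /asboolP[y /SN + <-].
case: (ex_maxnP exT bT) => m /asboolP[y [y0 ny] ym] max.
have Smax u : (sqnorm y < sqnorm u)%N -> leb.-negligible (overlap u).
  move=> yu; apply: contrapT => nu.
  have : (sqnorm u <= m)%N.
    apply: max; apply/asboolP; exists u => //; split => //.
    by rewrite -sqnorm_eq0 -lt0n (leq_ltn_trans _ yu).
  by rewrite -ym leqNgt yu.
apply: ny; apply/negligibleP; first exact: measurable_overlap.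
apply: (fourier_packing_null Bu (b0 := C *m ints y)).
- exact: measurable_overlap.
- exact: overlap_lty.
- by move=> k; have [] := @overlap_orthogonal y k; rewrite ?y0.
- by move=> k; have [] := @overlap_orthogonal y k; rewrite ?y0.
move=> g g0 [k gk].
have gA := dual_lattice_int Bu AB det_AB gk.
move: (invmx _ *m k) gA => k' gA.
have k'0 : k' != 0.
  by apply: contra_neq g0 => k'0; rewrite gA k'0 map_mx0 mulmx0.
(* Let x and x + g both lie in [overlap y]. If y + k' is the longer vector, x + g lies in the null
   set [overlap (y + k')]; otherwise x itself lies in [overlap (y - k')]. *)
have [/Smax yk|/Smax yk] := sqnorm_lt y k'0.
  apply: negligibleS (negligible_shift g yk).
  move=> x [[Kx Kxy] [Kxg Kxgy]]; split => //=.
  by rewrite gA map_mxD mulmxDr opprD addrACA subrr addr0.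
apply: negligibleS yk => x [[Kx Kxy] [Kxg Kxgy]]; split => //=.
by rewrite map_mxB mulmxBr opprB addrA -gA.
Qed.

Let K_shift (z : 'cV[int]_d) : set (euclid R d) :=
  [set x : 'cV[R]_d | K (x - A *m ints z)].

Lemma atom_notin l (x : euclid R d) : L l -> ~ (\bigcup_z K_shift z) x ->
  gabor_atom (normalized_indic K) l x = 0.
Proof.
move=> /lattice_blockP[z [k ->]] nx; rewrite gabor_atomE indicE memNset.
  by rewrite mulr0 !mul0r.
by move=> Kx; apply: nx; exists z.
Qed.

Let atom_measurable l : L l -> measurable_ReIm setT (gabor_atom (normalized_indic K) l).
Proof. by have [_ _ [[h _ _ _] _]] := K_gabor; move=> /h[]. Qed.

(** Off the translates of [K] every atom vanishes, so the squared distance from the indicator of an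
    uncovered piece to any combination of atoms is at least the measure of the piece; density makes
    it 0. *)
Lemma gabor_cover : leb.-negligible (~` \bigcup_z K_shift z).
Proof.
set N := ~` _.
have mN : measurable N.
  apply: measurableC; apply: countable_bigcupT_measurable; first exact: countableP.
  by move=> z; exact: measurable_euclid_shift.
(* Pieces of finite measure make the indicator square integrable. *)
have /sigma_finiteP[F [FT _ mF]] := sigma_finiteT leb.
have -> : N = \bigcup_k (N `&` F k) by rewrite -setI_bigcupr -FT setIT.
apply: negligible_bigcup => k.
have [mFk Fkoo] := mF k.
have mNk : measurable (N `&` F k) by exact: measurableI.
have Nkoo : (leb (N `&` F k) < +oo)%E.
  by apply: le_lt_trans Fkoo; apply: le_measure; rewrite ?inE//; exact: subIsetr.
apply/negligibleP => //.
set Nk := N `&` F k in mNk Nkoo *.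
pose f : euclid R d -> R[i] := patch (fun=> 0) Nk (fun=> 1).
have L2f : L2 setT f.
  apply: L2_restrict => //; split; [exact: measurable_cst..|].
  rewrite /L2dist2; under eq_integral do rewrite subr0 normr1 expr1n.
  by rewrite integral_cst// mul1e.
have [_ _ [[_ _ _ dense] _]] := K_gabor.
have le e : 0 < e -> (leb Nk <= (e ^+ 2)%:E)%E.
  move=> e0; have [m [t [a [Lt lt]]]] := dense f L2f e e0.
  apply: le_trans (ltW lt).
  have mg : measurable_ReIm setT
      (fun x => \sum_(j < m) a j * gabor_atom (normalized_indic K) (t j) x).
    by apply: measurable_ReIm_sum => j; exact: atom_measurable.
  have mf : measurable_ReIm setT f by have [] := L2f.
  apply: le_trans (@ge0_subset_integral _ _ _ leb Nk setT mNk measurableT _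
    (measurable_sqdist mf mg) _ _) => //; last first.
    by move=> x _; rewrite lee_fin Re_sqr_norm_ge0.
  rewrite (@eq_integral _ _ _ leb Nk (cst 1%E)) ?integral_cst ?mul1e//.
  move=> x /set_mem [Nx Fx]; rewrite /f /patch mem_set// big1.
    by rewrite subr0 normr1 expr1n.
  by move=> j _; rewrite atom_notin ?mulr0.
apply/eqP; rewrite eq_le measure_ge0 andbT.
apply/lee_addgt0Pr => e e0; rewrite add0e.
by rewrite -(sqr_sqrtr (ltW e0)); apply: le; rewrite sqrtr_gt0.
Qed.

(** The sign is that of [tiles], opposite to that of [K_shift]. *)
Definition uniquely_covered (x : 'cV[R]_d) :=
  exists! z : 'cV[int]_d, K (x + A *m ints z).

(** If x + A z and x + A z' both lie in [K], then x + A z lies in [overlap (z - z')], which is null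
    when z and z' differ. *)
Lemma uniquely_covered_ae : leb.-negligible (~` uniquely_covered).
Proof.
pose bad (p : 'cV[int]_d * 'cV[int]_d) : set (euclid R d) :=
  if p.1 == p.2 then set0
  else (fun x : 'cV[R]_d => x + A *m ints p.1) @^-1` overlap (p.1 - p.2).
have : leb.-negligible (~` (\bigcup_z K_shift z) `|` \bigcup_p bad p).
  apply: negligibleU; first exact: gabor_cover.
  apply: negligible_bigcup_countType => -[z z']; rewrite /bad/=.
  case: eqVneq => [_|zz']; first exact: negligible_set0.
  by apply/negligible_shift/overlap_null; rewrite subr_eq0.
apply: negligibleS => x /= nx; apply: contrapT => /not_orP[/contrapT[z _ Kxz] nb].
have Kz : K (x + A *m ints (- z)) by rewrite map_mxN mulmxN.
apply: nx; exists (- z); split => // z' Kz'; apply/eqP; rewrite -[_ == _]negbK.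
apply/negP => zz'; apply: nb; exists (- z, z') => //.
rewrite /bad/= (negbTE zz'); split => //=.
by rewrite map_mxB mulmxBr opprB -addrA [X in x + X]addrC subrK.
Qed.

Lemma uniquely_covered_shift x z :
  uniquely_covered x -> uniquely_covered (x + A *m ints z).
Proof.
move=> [y [Ky uy]]; exists (y - z); split.
  by rewrite map_mxB mulmxBr -addrA [A *m _ + _]addrC subrK.
move=> y'; rewrite -addrA -mulmxDr -map_mxD => /uy ->.
by rewrite addrC addKr.
Qed.

Lemma tiles_lattice : tiles K (lattice A).
Proof.
split; first exact: countable_lattice.
have := uniquely_covered_ae; apply: negligibleS; apply: subsetC => x [z [Kz uz]] /=.
rewrite (@eq_esum _ _ _ _ (fun t =>
    if t \in [set A *m ints z] then 1%E else 0%E)).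
  rewrite -esum_mkcondr (_ : _ `&` _ = [set A *m ints z]) ?esum_set1//.
  by apply/seteqP; split => [t []//|t /= ->]; split => //; exists z.
move=> _ [y _ <-]; rewrite indicE.
have [Ky|nKy] := pselect (K (x + A *m ints y)).
  by rewrite !mem_set//= (uz _ Ky).
rewrite !memNset//= => Az; apply: nKy.
by rewrite Az.
Qed.

(** On uniquely covered cosets [K] is already exact. The remaining points form a null set invariant
    under the lattice, where the half-open parallelepiped spanned by [A] supplies the
    representatives. *)
Lemma fundamental_domain_lattice : fundamental_domain (lattice A) K.
Proof.
pose frac (y : 'cV[R]_d) := A *m (\col_i fractional_part ((invmx A *m y) i ord0)).
have fracD y z : frac (y + A *m ints z) = frac y.
  congr (_ *m _); apply/colP => i; rewrite [LHS]mxE [RHS]mxE mulmxDr mulKmx//.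
  rewrite [X in fractional_part X]mxE [X in _ + X]mxE /fractional_part.
  by rewrite floorDrz ?intr_int// intrKfloor rmorphD/= opprD addrACA subrr addr0.
have fracE y : frac y = y + A *m ints (- \col_i Num.floor ((invmx A *m y) i ord0)).
  rewrite -[X in _ = X + _](mulKVmx Au) -mulmxDr; congr (_ *m _).
  by apply/colP => i; rewrite !mxE rmorphN.
pose K' : set (euclid R d) := (K `&` uniquely_covered) `|`
  [set y : 'cV[R]_d | ~ uniquely_covered y /\ frac y = y].
(* Completeness makes every subset of the exceptional null set measurable. *)
have mnull Y : Y `<=` ~` uniquely_covered -> measurable (Y : set (euclid R d)).
  by move=> h; apply: lebesgue_complete; exact: negligibleS uniquely_covered_ae.
have mU : measurable (uniquely_covered : set (euclid R d)).
  by rewrite -[X in measurable X]setCK; apply: measurableC; exact: mnull.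
split => //; first by exists A.
exists K'; last first.
  apply: measure_negligible.
    apply: measurableU.
      by apply: mnull => x [Kx nK'x] Ux; apply: nK'x; left.
    by apply: mnull => x [[[Kx _]|[]]].
  by apply: negligibleS uniquely_covered_ae => x [[Kx nK'x] Ux|[[[Kx _]|[]]]//];
    apply: nK'x; left.
split.
  apply: measurableU; first exact: measurableI.
  by apply: mnull => x [].
move=> x; have [Ux|nUx] := pselect (uniquely_covered x).
  have [z [Kz uz]] := Ux; exists (x + A *m ints z); split.
    split; last by exists (A *m ints z) => //; exists z.
    by left; split => //; exact: uniquely_covered_shift.
  move=> _ [/[swap]] [_ [y _ <-] <-] [[Ky _]|[nU _]]; first by rewrite (uz _ Ky).
  by exfalso; apply: nU; exact: uniquely_covered_shift.
have nU z : ~ uniquely_covered (x + A *m ints z).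
  move=> /(uniquely_covered_shift (- z)).
  by rewrite map_mxN mulmxN addrK.
exists (frac x); split.
  split; last by rewrite fracE; eexists => //; eexists.
  by right; split; [rewrite fracE|rewrite [X in frac X]fracE fracD].
move=> _ [/[swap]] [_ [y _ <-] <-] [[_ Uy]|[_]]; first by case: (nU y).
by rewrite fracD.
Qed.

Lemma inner_plane_wave (b b' : 'cV[R]_d) :
  inner_L2 K (plane_wave b) (plane_wave b') =
  (\int[leb]_(x in K) cos (2 * pi * dotp (b - b') x)) +i*
  (\int[leb]_(x in K) sin (2 * pi * dotp (b - b') x)).
Proof.
rewrite /inner_L2 /complex_integral; congr (_ +i* _);
  apply: eq_Rintegral => x _; rewrite dotpDl dotpNl (mulrBr (2 * pi)) /plane_wave.
  by rewrite cosB; simpc.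
by rewrite sinB; simpc; rewrite [LHS]addrC.
Qed.

Lemma plane_wave_ReIm D (b : 'cV[R]_d) : measurable_ReIm D (plane_wave b).
Proof.
have [mc _] := bounded_measurable_cos b; have [ms _] := bounded_measurable_sin b.
by split; [exact: measurable_funTS mc|exact: measurable_funTS ms].
Qed.

(** Approximate the zero extension of [f] by atoms on the whole space, then restrict to [K], which
    cannot increase the error. Almost everywhere on [K] the atoms with nonzero translation vanish,
    and the others are [c] times exponentials. *)
Lemma dense_span_plane_wave : dense_span K (lattice B) (plane_wave (d := d)).
Proof.
move=> f L2f e e0.
have [_ _ [[_ _ _ dense] _]] := K_gabor.
have L2f' := L2_restrict mK L2f.
have [m [t [a [Lt lt]]]] := dense _ L2f' e e0.
(* Terms with nonzero translation keep their index but get coefficient 0; the frequency 0 is then a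
   default member of [lattice B]. *)
pose t' j : 'cV[R]_d := if usubmx (t j) == 0 then dsubmx (t j) else 0.
pose a' j := if usubmx (t j) == 0 then a j * c%:C else 0.
exists m, t', a'; split=> [j|].
  rewrite /t'; case: eqVneq => [|_]; last first.
    by exists 0 => //; rewrite map_mx0 mulmx0.
  have [z [k ->]] := lattice_blockP (Lt j); rewrite col_mxKu col_mxKd => Az0.
  exists k => //; rewrite (_ : ints z = 0) ?mulmx0 ?add0r//.
  by rewrite -[LHS](mulKmx Au) Az0 mulmx0.
apply: le_lt_trans lt.
set h' := fun x => \sum_(j < m) a j * _.
set h := fun x => \sum_(j < m) a' j * _.
have mh : measurable_ReIm K h.
  by apply: measurable_ReIm_sum => j; exact: plane_wave_ReIm.
have mh' : measurable_ReIm setT h'.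
  by apply: measurable_ReIm_sum => j; exact: atom_measurable.
have mf : measurable_ReIm K f by have [] := L2f.
have mf' : measurable_ReIm setT (patch (fun=> 0) K f) by have [] := L2f'.
have mfh' := measurable_sqdist mf' mh'.
apply: (@le_trans _ _ (L2dist2 K (patch (fun=> 0) K f) h')); last first.
  apply: (@ge0_subset_integral _ _ _ leb K setT mK measurableT _ mfh') => //.
  by move=> x _; rewrite lee_fin Re_sqr_norm_ge0.
rewrite le_eqVlt; apply/orP; left; apply/eqP.
apply: (@ge0_ae_eq_integral _ _ _ leb K _ _ mK).
- exact: measurable_sqdist.
- exact: measurable_funTS.
- by move=> x _; rewrite lee_fin Re_sqr_norm_ge0.
- by move=> x _; rewrite lee_fin Re_sqr_norm_ge0.
pose bad (z : 'cV[int]_d) := if z == 0 then set0 else overlap z.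
have : leb.-negligible (\bigcup_z bad z).
  apply: negligible_bigcup_countType => z; rewrite /bad.
  by case: eqVneq => [_|/overlap_null//]; exact: negligible_set0.
apply: negligibleS => x /= /not_implyP[Kx]; apply: contra_notP => nbad.
rewrite /patch mem_set//; congr ((complex.Re (`|f x - _| ^+ 2))%:E).
apply: eq_bigr => j _; rewrite /a' /t'.
have [z [k tj]] := lattice_blockP (Lt j).
rewrite tj gabor_atomE col_mxKu col_mxKd indicE; case: eqVneq => [Az0|Az0].
  rewrite Az0 subr0 mem_set// mulr1 /plane_wave -mulrA; congr (_ * _).
  by simpc.
rewrite memNset ?mulr0 ?mul0r; first by rewrite mulr0.
move=> Kxz; apply: nbad; exists z => //; rewrite /bad ifN//.
by apply: contra_neq Az0 => ->; rewrite map_mx0 mulmx0.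
Qed.

(** Orthogonality of the exponentials is the case z = 0 of [overlap_orthogonal], where the overlap
    is [K] itself. *)
Lemma spectral_lattice : spectral K (lattice B).
Proof.
split; [exact: mK|by rewrite K0 Koo|exact: countable_lattice|].
split; last exact: dense_span_plane_wave.
- move=> b _; have [Rb Ib] := plane_wave_ReIm K b; split => //.
  rewrite /L2dist2 (@eq_integral _ _ _ leb K (cst 1%E)) ?integral_cst ?mul1e//.
  by move=> x _; rewrite subr0 Re_sqr_norm /= cos2Dsin2.
- move=> b _; rewrite inner_plane_wave subrr => -[].
  under eq_Rintegral do rewrite dotp0l mulr0 cos0.
  rewrite Rintegral_cst// mul1r => /eqP.
  by rewrite gt_eqF// fine_gt0// K0 Koo.
- move=> _ _ [k _ <-] [k' _ <-] neq; rewrite inner_plane_wave -mulmxBr -map_mxB.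
  have kk' : k - k' != 0 by rewrite subr_eq0; apply: contra_not_neq neq => ->.
  have := @overlap_orthogonal 0 (k - k').
  by rewrite kk' orbT overlap0 map_mx0 mulmx0 add0r => /(_ isT)[-> ->].
Qed.

End gabor_lattice.

Theorem theorem1p4 (R : realType) (d : nat) (A B C : 'M[R]_d)
    (K : set (euclid R d))
    (K_bounded : bounded_set (K : set 'cV[R]_d))
    (K_measurable : measurable K)
    (K_pos : (0 < lebesgue R d K)%E)
    (det_AB : `|\det (A *m B)| = 1)
    (K_gabor : gabor_orthonormal_basis (normalized_indic K)
                 (lattice (block_mx A 0 C B)))
    (AtB_int : A^T *m B \is a mxOver Num.int) :
  [/\ (exists J, tiles K J) /\ (exists L, spectral K L),
      fundamental_domain (lattice A) K /\
        fundamental_domain (lattice (invmx B)^T) K,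
      tiles K (lattice A) &
      spectral K (lattice B)].
Proof.
have : \det (A *m B) != 0 by rewrite -normr_eq0 det_AB oner_eq0.
rewrite det_mulmx mulf_eq0 => /norP[Au Bu].
rewrite -unitfE -unitmxE in Au; rewrite -unitfE -unitmxE in Bu.
have [P AB] := integral_pairing AtB_int.
have Koo := bounded_lebesgue_lty K_bounded K_measurable.
have tK := tiles_lattice Au Bu K_measurable K_pos Koo K_gabor
  K_bounded AB det_AB.
have sK := spectral_lattice Au Bu K_measurable K_pos Koo K_gabor
  K_bounded AB det_AB.
have fK := fundamental_domain_lattice Au Bu K_measurable K_pos Koo K_gabor
  K_bounded AB det_AB.
split=> //; first by split; eexists; [exact: tK|exact: sK].
(* The two fundamental domain claims coincide, [A Z^d] being the dual lattice of [B Z^d]. *)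
by split=> //; rewrite -(lattice_dual Bu AB det_AB).
Qed.
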